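(* Let $H,K$ be Hilbert spaces, and let $V\subseteq\mathcal{B}(K,H)$ be a dual TRO, with isometric predual $V_*$. Let $C=\overline{\operatorname{lin}}\{xy^*:x,y\in V\}$ and $D=\overline{\operatorname{lin}}\{x^*y:x,y\in V\}$. Regarding $V$ as a $C$-$D$-bimodule, so that $V^*$ is a $D$-$C$-bimodule, $V_*\subseteq V^*$ is a submodule. Moreover, given a partial isometry $r\in V$, the $C^*$-algebra $V_{(r)}$ is, as a subspace of $V$, weak$^*$-closed, and hence is a $W^*$-algebra.
   Context: A TRO (ternary ring of operators) is a norm-closed subspace $V\subseteq\mathcal{B}(K,H)$ such that $xy^*z\in V$ for all $x,y,z\in V$. Then $C\subseteq\mathcal{B}(H)$ and $D\subseteq\mathcal{B}(K)$ are $C^*$-algebras with $CV\subseteq V$ and $VD\subseteq V$, so $V$ is a $C$-$D$-bimodule. The Banach space dual $V^*$ has the dual $D$-$C$-bimodule structure $\langle d\cdot\mu\cdot c,x\rangle=\langle\mu,cxd\rangle$ for $\mu\in V^*$, $c\in C$, $d\in D$, $x\in V$. $V$ is a dual TRO if it is isometrically isomorphic to the dual of a Banach space $V_*$; then $V_*$ is regarded as a subspace of $V^*$ via the canonical map $V_*\to V_*^{**}=V^*$, and the weak$^*$-topology on $V$ is $\sigma(V,V_* )$. For a partial isometry $r\in V$, define $V_{(r)}=\{x\in V: rr^*x=x=xr^*r\}=\{rr^*xr^*r:x\in V\}$. With the norm of $V$, the product $x\bullet y=xr^*y$ and the involution $x^\flat=rx^*r$, this is a unital $C^*$-algebra with unit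 $r$. A $W^*$-algebra is a $C^*$-algebra which is isometrically isomorphic to a dual Banach space. *)

(* Defs.v *)
From HB Require Import structures.
From mathcomp Require Import all_boot all_order all_algebra sesquilinear.
From mathcomp Require Import complex ring lra.
From mathcomp Require Import boolp classical_sets functions interval_inference.
From mathcomp Require Import reals topology normedtype sequences.

(* Scalars are R[i] for an arbitrary R : realType; norms
   take their (real, nonnegative) values in R[i].  Inner products are linear
   in the first and conjugate-linear in the second argument. *)

Set Implicit Arguments.
Unset Strict Implicit.
Unset Printing Implicit Defensive.

Import Order.TTheory GRing.Theory Num.Theory.
Import numFieldNormedType.Exports.

Local Open Scope classical_set_scope.
Local Open Scope complex_scope.
Local Open Scope ring_scope.

HB.mixin Record CompleteNormedModule_isHilbert (R : realType) E
    & CompleteNormedModule R[i] E := {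
  inner : {dot E for Num.conj};
  sqr_norm_inner : forall x : E, `|x| ^+ 2 = inner x x
}.

#[short(type="hilbertType")]
HB.structure Definition Hilbert (R : realType) :=
  {E of CompleteNormedModule R[i] E & CompleteNormedModule_isHilbert R E}.

(* A linear subspace S, with [linsub_type S] its elements as a normed space. *)
Record linsub (K : numFieldType) (E : normedModType K) := LinSub {
  linsub_set : set E;
  linsub_closed : submod_closed (mem linsub_set)
}.

Section sub.
Context (K : numFieldType) (E : normedModType K) (S : linsub E).

Definition linsub_pred : {pred E} := mem (linsub_set S).
HB.instance Definition _ := GRing.isSubmodClosed.Build K E linsub_pred (linsub_closed S).

Record linsub_type := LinSubElt { linsub_val :> E; linsub_valP : linsub_val \in linsub_pred }.
HB.instance Definition _ := [isSub for linsub_val].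
HB.instance Definition _ := [Choice of linsub_type by <:].
HB.instance Definition _ := [SubChoice_isSubLmodule of linsub_type by <:].

Definition linsub_norm (x : linsub_type) : K := `|linsub_val x|.
Lemma linsub_normD x y : linsub_norm (x + y) <= linsub_norm x + linsub_norm y.
Proof. exact: ler_normD. Qed.
Lemma linsub_normZ (a : K) x : linsub_norm (a *: x) = `|a| * linsub_norm x.
Proof. exact: normrZ. Qed.
Lemma linsub_norm0 x : linsub_norm x = 0 -> x = 0.
Proof. by move=> /eqP; rewrite normr_eq0 => /eqP x0; apply: val_inj. Qed.
HB.instance Definition _ := Lmodule_isNormed.Build K linsub_type
  linsub_normD linsub_normZ linsub_norm0.
End sub.

Section bop.
Context (R : realType) (E F : normedModType R[i]).

Definition bounded_linear : set (E -> F) :=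
  [set f | linear f /\ exists M : R[i], forall x, `|f x| <= M * `|x|].

Definition bop_pred : {pred E -> F} := mem bounded_linear.

Lemma bop_pred_submod : submod_closed bop_pred.
Proof.
split=> [|a f g]; rewrite !inE.
  split=> [b x y|]; first by rewrite /= scaler0 addr0.
  by exists 0 => x; rewrite normr0 mul0r.
move=> [lf [M fM]] [lg [N gN]]; split=> [b x y|].
  rewrite !fctE /= lf lg !scalerDr !scalerA -!addrA; congr (_ + _).
    by rewrite mulrC.
  by rewrite addrCA.
exists (`|a| * M + N) => x.
rewrite (le_trans (ler_normD _ _))// mulrDl lerD// normrZ -mulrA.
by rewrite ler_wpM2l.
Qed.
HB.instance Definition _ :=
  GRing.isSubmodClosed.Build R[i] (E -> F) bop_pred bop_pred_submod.

Record bop := Bop { bop_fun :> E -> F; bopP : bop_fun \in bop_pred }.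

HB.instance Definition _ := [isSub for bop_fun].
HB.instance Definition _ := [Choice of bop by <:].
HB.instance Definition _ := [SubChoice_isSubLmodule of bop by <:].

Lemma bop_linear (f : bop) : linear f.
Proof. by case: f => f /= /[!inE] -[]. Qed.

HB.instance Definition _ (f : bop) :=
  GRing.isLinear.Build R[i] E F *:%R f (bop_linear f).

(* [sup] lives on R, hence the real part of the R[i]-valued norm *)
Definition opnorm (f : bop) : R[i] :=
  (sup [set complex.Re `|f x| | x in [set x : E | `|x| <= 1]])%:C.

Lemma Re_le (x y : R[i]) : x <= y -> complex.Re x <= complex.Re y.
Proof. by case: x => a b; case: y => c d; rewrite lecE /= => /andP[]. Qed.

Lemma Re_norm (G : normedModType R[i]) (x : G) : (complex.Re `|x|)%:C = `|x|.
Proof. by rewrite RRe_real// ger0_real. Qed.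

Lemma bop_bounded (f : bop) :
  exists2 M : R[i], 0 <= M & forall x, `|f x| <= M * `|x|.
Proof.
case: f => f /= /[!inE] -[_ [M fM]]; exists `|M| => // x.
rewrite -[`|x|]normr_id -normrM ger0_norm//.
exact: le_trans (fM x).
Qed.

Lemma opnorm_has_sup (f : bop) :
  has_sup [set complex.Re `|f x| | x in [set x : E | `|x| <= 1]].
Proof.
split; first by exists (complex.Re `|f 0|), 0 => //=; rewrite normr0.
have [M M0 fM] := bop_bounded f.
exists (complex.Re M) => _ [x /= x1 <-].
by apply: Re_le; rewrite (le_trans (fM x))// ler_piMr.
Qed.

Lemma opnorm_ge0 f : 0 <= opnorm f.
Proof.
rewrite ler0c; apply: ub_le_sup.
  by have [] := opnorm_has_sup f.
by exists 0; rewrite /= ?linear0 ?normr0.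
Qed.

Lemma opnormP (f : bop) (x : E) : `|f x| <= opnorm f * `|x|.
Proof.
have [->|x0] := eqVneq x 0; first by rewrite linear0 !normr0 mulr0.
have nx0 : 0 < `|x| by rewrite normr_gt0.
rewrite -ler_pdivrMr// mulrC -[`|x|^-1]ger0_norm ?invr_ge0// -normrZ.
rewrite -linearZ -[X in X <= _]Re_norm /opnorm lecR; apply: ub_le_sup.
  by have [] := opnorm_has_sup f.
by exists (`|x|^-1 *: x) => //=; rewrite normfZV.
Qed.

Lemma opnorm_le (f : bop) (M : R[i]) : 0 <= M ->
  (forall x, `|f x| <= M * `|x|) -> opnorm f <= M.
Proof.
move=> M0 fM; rewrite -(RRe_real (ger0_real M0)) /opnorm lecR; apply: ge_sup.
  by have [] := opnorm_has_sup f.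
move=> _ [x /= x1 <-]; apply: Re_le; rewrite (le_trans (fM x))//.
by rewrite ler_piMr.
Qed.

Lemma opnorm_normD f g : opnorm (f + g) <= opnorm f + opnorm g.
Proof.
apply: opnorm_le => [|x]; first by rewrite addr_ge0// opnorm_ge0.
by rewrite (le_trans (ler_normD _ _))// mulrDl lerD// opnormP.
Qed.

Lemma opnormZ_le (a : R[i]) f : opnorm (a *: f) <= `|a| * opnorm f.
Proof.
apply: opnorm_le => [|x]; first by rewrite mulr_ge0// opnorm_ge0.
by rewrite normrZ -mulrA ler_wpM2l// opnormP.
Qed.

Lemma opnormZ (a : R[i]) f : opnorm (a *: f) = `|a| * opnorm f.
Proof.
apply/eqP; rewrite eq_le opnormZ_le /=.
have [->|a0] := eqVneq a 0; first by rewrite normr0 mul0r opnorm_ge0.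
rewrite -ler_pdivlMl ?normr_gt0// -normfV.
by rewrite -{1}[f](scalerK a0) opnormZ_le.
Qed.

Lemma opnorm_eq0 f : opnorm f = 0 -> f = 0.
Proof.
move=> f0; apply: val_inj; apply/funext => x /=.
apply/eqP; rewrite -normr_eq0 eq_le normr_ge0 andbT.
by rewrite (le_trans (opnormP f x))// f0 mul0r.
Qed.

HB.instance Definition _ := Lmodule_isNormed.Build R[i] bop
  opnorm_normD opnormZ opnorm_eq0.

End bop.

Section bop_theory.
Context (R : realType).
Implicit Types E F G : normedModType R[i].

Definition dual E := bop E R[i]^o.

Lemma bop_ub E F (f : bop E F) x : `|f x| <= `|f| * `|x|.
Proof. exact: opnormP. Qed.

Lemma bop_le E F (f : bop E F) (M : R[i]) : 0 <= M ->
  (forall x, `|f x| <= M * `|x|) -> `|f| <= M.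
Proof. exact: opnorm_le. Qed.

Lemma bop_ext E F (f g : bop E F) : (f : E -> F) =1 g -> f = g.
Proof. by move=> fg; apply: val_inj; apply/funext. Qed.

Definition mk_bop E F (f : E -> F) (lf : linear f) (M : R[i])
  (fM : forall x, `|f x| <= M * `|x|) : bop E F :=
  @Bop R E F f (mem_set (conj lf (ex_intro _ M fM))).

Lemma bop_comp_linear E F G (g : bop F G) (f : bop E F) : linear (g \o f).
Proof. by move=> a x y /=; rewrite !linearP. Qed.

Lemma bop_comp_bounded E F G (g : bop F G) (f : bop E F) x :
  `|(g \o f) x| <= `|g| * `|f| * `|x|.
Proof. by rewrite /= (le_trans (bop_ub _ _))// -mulrA ler_wpM2l// bop_ub. Qed.

Definition bop_comp E F G (g : bop F G) (f : bop E F) : bop E G :=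
  mk_bop (bop_comp_linear g f) (bop_comp_bounded g f).

End bop_theory.
Notation "g '\oB' f" := (bop_comp g f) (at level 50, left associativity) : ring_scope.

Section inner_theory.
Context (R : realType) (E : hilbertType R).
Implicit Types x y z : E.

Lemma innerC x y : inner x y = (inner y x)^*.
Proof. by rewrite (hermitian_subproof (s := inner)) expr0 mul1r. Qed.

Lemma innerDl x y z : inner (x + y) z = inner x z + inner y z.
Proof. exact: linearDl. Qed.

Lemma innerZl (a : R[i]) x y : inner (a *: x) y = a * inner x y.
Proof. exact: linearZl_LR. Qed.

Lemma innerDr x y z : inner x (y + z) = inner x y + inner x z.
Proof. by rewrite innerC innerDl rmorphD/= -!innerC. Qed.

Lemma innerZr (a : R[i]) x y : inner x (a *: y) = a^* * inner x y.
Proof. by rewrite innerC innerZl rmorphM/= -innerC. Qed.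

Lemma innerNl x y : inner (- x) y = - inner x y.
Proof. by rewrite -scaleN1r innerZl mulN1r. Qed.

Lemma innerNr x y : inner x (- y) = - inner x y.
Proof. by rewrite innerC innerNl rmorphN/= -innerC. Qed.

Lemma innerBl x y z : inner (x - y) z = inner x z - inner y z.
Proof. by rewrite innerDl innerNl. Qed.

Lemma innerBr x y z : inner x (y - z) = inner x y - inner x z.
Proof. by rewrite innerDr innerNr. Qed.

Lemma inner0l x : inner 0 x = 0.
Proof. by rewrite -(scale0r 0) innerZl mul0r. Qed.

Lemma inner0r x : inner x 0 = 0.
Proof. by rewrite innerC inner0l conjC0. Qed.

Lemma inner_eq0 x : inner x x = 0 -> x = 0.
Proof. by move/eqP; rewrite -sqr_norm_inner sqrf_eq0 normr_eq0 => /eqP. Qed.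

Lemma inner_ext x y : (forall z, inner z x = inner z y) -> x = y.
Proof.
move=> xy; apply/eqP; rewrite -subr_eq0; apply/eqP/inner_eq0.
by rewrite innerBr xy subrr.
Qed.

Lemma parallelogram x y :
  `|x - y| ^+ 2 = 2 * `|x| ^+ 2 + 2 * `|y| ^+ 2 - `|x + y| ^+ 2.
Proof.
rewrite !sqr_norm_inner !(innerBl, innerBr, innerDl, innerDr).
by ring.
Qed.

Lemma sqr_norm_proj x y : y != 0 ->
  `|x - (inner x y / `|y| ^+ 2) *: y| ^+ 2 =
  `|x| ^+ 2 - `|inner x y| ^+ 2 / `|y| ^+ 2.
Proof.
move=> y0; have yy0 : inner y y != 0 by apply: contra_neq y0 => /inner_eq0.
rewrite normCK !sqr_norm_inner !(innerBl, innerBr, innerZl, innerZr).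
rewrite [inner y x]innerC rmorphM/= fmorphV/= -[(inner y y)^*]innerC.
by field.
Qed.

Lemma Cauchy_Schwarz x y : `|inner x y| <= `|x| * `|y|.
Proof.
have [->|y0] := eqVneq y 0; first by rewrite inner0r !normr0 mulr0.
rewrite -(@ler_pXn2r _ 2)// ?nnegrE ?mulr_ge0// exprMn.
rewrite -ler_pdivrMr ?exprn_gt0 ?normr_gt0//.
by rewrite -subr_ge0 -sqr_norm_proj// exprn_ge0.
Qed.

End inner_theory.

Section riesz.
Context (R : realType) (E : hilbertType R) (f : dual E).

Let q (x : E) : R := complex.Re (`|x| ^+ 2).

Let qE x : (q x)%:C = `|x| ^+ 2.
Proof. by rewrite /q RRe_real// ger0_real// exprn_ge0. Qed.

Let q_ge0 x : 0 <= q x.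
Proof. by rewrite -ler0c qE exprn_ge0. Qed.

Let qZ (a : R) x : q (a%:C *: x) = a ^+ 2 * q x.
Proof.
apply: complexI; rewrite rmorphM rmorphXn /= !qE normrZ exprMn; congr (_ * _).
by rewrite real_normK// complex_real.
Qed.

Let A := [set x : E | f x = 1].
Let d := inf (q @` A).

Let d_le x : A x -> d <= q x.
Proof.
move=> Ax; apply: ge_inf; last by exists x.
by exists 0 => _ [y _ <-].
Qed.

Let q_sub x y : A x -> A y -> q (x - y) <= 2 * (q x - d) + 2 * (q y - d).
Proof.
move=> Ax Ay.
have -> : q (x - y) = 2 * q x + 2 * q y - q (x + y).
  apply: complexI; rewrite !(rmorphD, rmorphN, rmorphM, rmorph_nat)/= !qE.
  exact: parallelogram.
have : d <= q ((2^-1)%:C *: (x + y)).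
  apply: d_le; rewrite /A /= linearZ linearD /= Ax Ay.
  have -> : (2^-1 : R)%:C = 2^-1 by rewrite fmorphV rmorph_nat.
  by rewrite /GRing.scale/= mulVf// pnatr_eq0.
rewrite qZ; lra.
Qed.

Let approx (f0 : exists x, f x != 0) :
  exists z, forall e : R[i], 0 < e ->
    exists x, [/\ A x, `|z - x| <= e & (q x - d)%:C <= e ^+ 2].
Proof.
have A0 : A !=set0.
  have [x x0] := f0; exists ((f x)^-1 *: x).
  by rewrite /A /= linearZ/= /GRing.scale/= mulVf.
have hinf : has_inf (q @` A).
  split; first by have [x Ax] := A0; exists (q x), x.
  by exists 0 => _ [y _ <-].
have hu n : exists x, A x /\ q x < d + n.+1%:R^-1.
  have [|_ [x Ax <-] qx] := @inf_adherent _ (q @` A) n.+1%:R^-1 _ hinf.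
    by rewrite invr_gt0.
  by exists x.
have {hu} [u uP] := choice hu.
have small (e : R) : 0 < e -> \forall n \near \oo, q (u n) - d < e.
  move=> e0; near=> n; rewrite ltrBlDl.
  have [_ /lt_trans] := uP n; apply.
  rewrite ltrD2l; near: n.
  exact: (near_infty_natSinv_lt (PosNum e0)).
have eRe (e : R[i]) : 0 < e -> e = (complex.Re e)%:C /\ 0 < complex.Re e.
  move=> e0; have h : (complex.Re e)%:C = e by rewrite RRe_real// gtr0_real.
  by split=> //; rewrite -ltcR h.
have cu : cvg (u @ \oo).
  apply: cauchy_cvg; apply: cauchy_exP => _/posnumP[e].
  have [eE e0] := eRe e%:num [gt0 of e%:num].
  have e20 : 0 < complex.Re e%:num ^+ 2 / 4 by rewrite divr_gt0// exprn_gt0.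
  have [N _ hN] := small _ e20.
  exists (u N); exists N => // n /= Nn.
  rewrite -ball_normE /= -(@ltr_pXn2r _ 2)// ?nnegrE//.
  rewrite -qE [ltRHS](_ : _ = (complex.Re e%:num ^+ 2)%:C); last first.
    by rewrite {1}eE rmorphXn.
  rewrite ltcR.
  have := q_sub (uP N).1 (uP n).1.
  by have := hN N (leqnn N); have := hN n Nn => /=; lra.
exists (lim (u @ \oo)) => e e0.
have [eE re0] := eRe e e0.
near \oo => n; exists (u n); split.
- exact: (uP n).1.
- near: n; by move: cu => /cvgrPdist_le; apply.
- rewrite eE -rmorphXn lecR ltW//; near: n; apply: small.
  by rewrite exprn_gt0.
Unshelve. all: by end_near. Qed.

Let small0 (y M : R[i]) : 0 <= y -> 0 <= M ->
  (forall e, 0 < e -> y <= M * e) -> y = 0.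
Proof.
move=> y0 M0 h; have [//|yn0] := eqVneq y 0; exfalso.
have M1 : 0 < M + 1 by rewrite ltr_wpDl.
have yp : 0 < y by rewrite lt_def yn0.
have := h (y / (M + 1)) (divr_gt0 yp M1).
rewrite mulrA ler_pdivlMr// mulrDr mulr1 mulrC gerDl => /(lt_le_trans yp).
by rewrite ltxx.
Qed.

Theorem Riesz : exists z, forall x, f x = inner x z.
Proof.
have [f0|/existsNP[x0 /eqP f0]] := pselect (forall x, f x = 0).
  by exists 0 => x; rewrite f0 inner0r.
have [z zP] := approx (ex_intro _ x0 f0).
have fz : f z = 1.
  apply/eqP; rewrite -subr_eq0 -normr_eq0; apply/eqP.
  apply: (@small0 _ `|f|); [exact: normr_ge0|exact: normr_ge0|move=> e e0].
  have [x [Ax zx _]] := zP e e0.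
  by rewrite -Ax -linearB (le_trans (bop_ub _ _))// ler_wpM2l.
have ortho k : f k = 0 -> inner k z = 0.
  move=> fk; have [->|k0] := eqVneq k 0; first by rewrite inner0l.
  have nk0 : 0 < `|k| ^+ 2 by rewrite exprn_gt0// normr_gt0.
  apply/eqP; rewrite innerC conjC_eq0 -normr_eq0; apply/eqP.
  apply: (@small0 _ (2 * `|k|)); [exact: normr_ge0|exact: mulr_ge0|move=> e e0].
  have [x [Ax zx qx]] := zP e e0.
  rewrite -[z](subrK x) innerDl (le_trans (ler_normD _ _))//.
  rewrite -mulrA mulr_natl mulr2n lerD//.
    by rewrite (le_trans (Cauchy_Schwarz _ _))// mulrC ler_wpM2l.
  have e0' := ltW e0.
  rewrite -(@ler_pXn2r _ 2)// ?nnegrE ?mulr_ge0// exprMn mulrC.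
  rewrite -ler_pdivrMr// (le_trans _ qx)//.
  have Axk : A (x - (inner x k / `|k| ^+ 2) *: k).
    by rewrite /A /= linearB linearZ /= fk scaler0 subr0.
  have := d_le Axk; rewrite -lecR qE sqr_norm_proj//.
  by rewrite rmorphB/= qE lerBrDl lerBrDr addrC.
have z0 : z != 0.
  by apply/eqP => z0; move: fz; rewrite z0 linear0 => /eqP; rewrite eq_sym oner_eq0.
have nz0 : inner z z != 0 by apply: contra_neq z0 => /inner_eq0.
exists ((inner z z)^-1 *: z) => x.
rewrite innerZr fmorphV/= -[(inner z z)^*]innerC.
apply: (mulfI nz0); rewrite mulrA mulfV// mul1r mulrC.
apply/eqP; rewrite -subr_eq0 -innerZl -innerBl -opprB innerNl oppr_eq0.
apply/eqP/ortho; rewrite linearB linearZ /= fz.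
by rewrite /GRing.scale /= mulr1 subrr.
Qed.

End riesz.

Section adjoint.
Context (R : realType).
Implicit Types E F : hilbertType R.

Definition is_adjoint E F (x : bop E F) (y : bop F E) :=
  forall (u : E) (v : F), inner (x u) v = inner u (y v).

Lemma adjoint_subproof E F (x : bop E F) : exists y, is_adjoint x y.
Proof.
have hz v : exists z, forall u, inner (x u) v = inner u z.
  have lf : linear (fun u => inner (x u) v : R[i]^o).
    by move=> a u w; rewrite linearP innerDl innerZl.
  have bf u : `|inner (x u) v : R[i]^o| <= `|x| * `|v| * `|u|.
    rewrite (le_trans (Cauchy_Schwarz _ _))// mulrAC ler_wpM2r//.
    exact: bop_ub.
  exact: (Riesz (mk_bop lf bf)).
have [g gP] := choice hz.
have lg : linear g.
  move=> a v w; apply: inner_ext => u.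
  by rewrite -gP innerDr innerZr !gP innerDr innerZr.
have bg v : `|g v| <= `|x| * `|v|.
  have [->|g0] := eqVneq (g v) 0; first by rewrite normr0 mulr_ge0.
  rewrite -(@ler_pM2r _ `|g v|) ?normr_gt0// -expr2 sqr_norm_inner -gP.
  rewrite -[inner _ _]ger0_norm; last by rewrite gP -sqr_norm_inner exprn_ge0.
  by rewrite (le_trans (Cauchy_Schwarz _ _))// mulrAC ler_wpM2r// bop_ub.
by exists (mk_bop lg bg) => u v; rewrite gP.
Qed.

Definition adjoint E F (x : bop E F) : bop F E := sval (cid (adjoint_subproof x)).

Lemma adjointP E F (x : bop E F) : is_adjoint x (adjoint x).
Proof. by rewrite /adjoint; case: cid. Qed.

Lemma adjoint_unique E F (x : bop E F) (y : bop F E) :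
  is_adjoint x y -> y = adjoint x.
Proof.
by move=> xy; apply: bop_ext => v; apply: inner_ext => u; rewrite -xy adjointP.
Qed.

Lemma adjointK E F (x : bop E F) : adjoint (adjoint x) = x.
Proof.
by apply/esym/adjoint_unique => u v; rewrite innerC -adjointP -innerC.
Qed.

Lemma adjoint_comp E F (G : hilbertType R) (x : bop F G) (y : bop E F) :
  adjoint (x \oB y) = adjoint y \oB adjoint x.
Proof.
by apply/esym/adjoint_unique => u v; rewrite /= !adjointP.
Qed.

End adjoint.

Section closed_span.
Context (K : numFieldType) (E : normedModType K).

Definition span (A : set E) : set E :=
  smallest (fun S : set E => submod_closed (mem S)) A.

Lemma span_submod (A : set E) : submod_closed (mem (span A)).
Proof.
split; first by rewrite inE => S [[S0 _] _]; rewrite inE in S0.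
move=> a x y; rewrite !inE => Ax Ay S [[S0 SD] AS].
have := SD a x y; rewrite !inE; apply; [exact: Ax|exact: Ay].
Qed.

Lemma closure_distP (A : set E) x :
  closure A x <-> forall e : K, 0 < e -> exists2 y, A y & `|x - y| < e.
Proof.
split=> [Ax e e0|h B /nbhs_normP[e e0 eB]].
  have [y [Ay]] := Ax _ (nbhsx_ballx x e e0).
  by rewrite -ball_normE; exists y.
by have [y Ay xy] := h e e0; exists y; split => //; apply: eB.
Qed.

Lemma closed_span_subproof (A : set E) : submod_closed (mem (closure (span A))).
Proof.
have [S0 SD] := span_submod A; split.
  by rewrite !inE in S0 *; apply: (@subset_closure _ (span A)); exact: S0.
move=> a x y; rewrite !inE => /closure_distP Ax /closure_distP Ay.
apply/closure_distP => e e0.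
have a0 : 0 < `|a| + 1 by rewrite ltr_wpDl.
have [u Au xu] := Ax (e / 2 / (`|a| + 1)) (divr_gt0 (divr_gt0 e0 (ltr0n _ 2)) a0).
have [v Av yv] := Ay (e / 2) (divr_gt0 e0 (ltr0n _ 2)).
exists (a *: u + v); first by have := SD a u v; rewrite !inE; apply.
rewrite opprD addrACA -scalerBr (le_lt_trans (ler_normD _ _))//.
rewrite [e in _ < e]splitr ltr_leD// ?ltW// normrZ.
rewrite ltr_pdivlMr// in xu; rewrite (le_lt_trans _ xu)// mulrC ler_wpM2l//.
by rewrite lerDl.
Qed.

Definition closed_span (A : set E) : linsub E := LinSub (closed_span_subproof A).

Lemma closed_span_sub (A : set E) (S : linsub E) :
  closed (linsub_set S) -> A `<=` linsub_set S ->
  linsub_set (closed_span A) `<=` linsub_set S.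
Proof.
move=> Scl AS; rewrite [X in _ `<=` X](closure_id (linsub_set S)).1//; apply: closure_subset.
by apply: smallest_sub => //; exact: linsub_closed.
Qed.

End closed_span.

Definition linsub_normed (K : numFieldType) (E : normedModType K)
  (S : linsub E) : normedModType K := linsub_type S.
Coercion linsub_normed : linsub >-> NormedModule.type.

Lemma linsubP (K : numFieldType) (E : normedModType K) (S : linsub E) (x : S) :
  linsub_set S (linsub_val x).
Proof. exact: set_mem (linsub_valP x). Qed.

Definition mk_linsub (K : numFieldType) (E : normedModType K) (S : linsub E)
  (x : E) (Sx : linsub_set S x) : S := @LinSubElt K E S x (mem_set Sx).
Arguments mk_linsub {K E} S {x} Sx.

Section comp_theory.
Context (R : realType).
Implicit Types E F G : normedModType R[i].

Lemma bop_compA E F G (L : normedModType R[i])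
    (h : bop G L) (g : bop F G) (f : bop E F) :
  h \oB (g \oB f) = h \oB g \oB f.
Proof. exact: bop_ext. Qed.

Lemma bop_comp_linl E F G a (g h : bop F G) (f : bop E F) :
  (a *: g + h) \oB f = a *: (g \oB f) + (h \oB f).
Proof. exact: bop_ext. Qed.

Lemma bop_comp_linr E F G a (f g : bop E F) (h : bop F G) :
  h \oB (a *: f + g) = a *: (h \oB f) + (h \oB g).
Proof. by apply: bop_ext => x; rewrite /= linearP. Qed.

Lemma bop_comp_norm E F G (g : bop F G) (f : bop E F) :
  `|g \oB f| <= `|g| * `|f|.
Proof. by apply: bop_le => [|x]; [rewrite mulr_ge0|exact: bop_comp_bounded]. Qed.

Lemma preim_linsub_subproof E F (f : bop E F) (S : linsub F) :
  submod_closed (mem (f @^-1` linsub_set S)).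
Proof.
have [S0 SD] := linsub_closed S; split.
  by rewrite !inE in S0 *; rewrite /= linear0.
by move=> a x y; have := SD a (f x) (f y); rewrite !inE /= linearP.
Qed.

Definition preim_linsub E F (f : bop E F) S : linsub E :=
  LinSub (preim_linsub_subproof f S).

Lemma preim_linsub_closed E F (f : bop E F) (S : linsub F) :
  closed (linsub_set S) -> closed (linsub_set (preim_linsub f S)).
Proof.
move=> Scl x /closure_distP h; apply: Scl; apply/closure_distP => e e0.
have f1 : 0 < `|f| + 1 by rewrite ltr_wpDl.
have [y Sy xy] := h (e / (`|f| + 1)) (divr_gt0 e0 f1).
exists (f y) => //; rewrite -linearB (le_lt_trans (bop_ub _ _))//.
rewrite ltr_pdivlMr// in xy; rewrite (le_lt_trans _ xy)// mulrC ler_wpM2l//.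
by rewrite lerDl.
Qed.

Lemma compl_linear E F G (f : bop E F) :
  linear (fun g : bop F G => g \oB f).
Proof. by move=> a g h; exact: bop_comp_linl. Qed.

Lemma compl_bounded E F G (f : bop E F) (g : bop F G) :
  `|g \oB f| <= `|f| * `|g|.
Proof. by rewrite mulrC bop_comp_norm. Qed.

Definition compl E F G (f : bop E F) : bop (bop F G) (bop E G) :=
  mk_bop (@compl_linear E F G f) (compl_bounded f).

Lemma compr_linear E F G (h : bop F G) :
  linear (fun f : bop E F => h \oB f).
Proof. by move=> a g f; exact: bop_comp_linr. Qed.

Definition compr E F G (h : bop F G) : bop (bop E F) (bop E G) :=
  mk_bop (@compr_linear E F G h) (bop_comp_norm h).

End comp_theory.

Record tro (R : realType) (K H : hilbertType R) := Tro {
  tro_space :> linsub (bop K H);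
  tro_closed : closed (linsub_set tro_space);
  tro_ternary : forall x y z : bop K H,
    linsub_set tro_space x -> linsub_set tro_space y -> linsub_set tro_space z ->
    linsub_set tro_space (x \oB adjoint y \oB z)
}.

Section tro_theory.
Context (R : realType) (K H : hilbertType R) (V : tro K H).
Implicit Types (x y z r : V).

Let val (x : V) : bop K H := linsub_val x.

(* The C*-algebras C on the left and D on the right of the bimodule V *)
Definition tro_left : linsub (bop H H) :=
  closed_span [set val x \oB adjoint (val y) | x in setT & y in setT].

Definition tro_right : linsub (bop K K) :=
  closed_span [set adjoint (val x) \oB val y | x in setT & y in setT].

Lemma tro_left_subproof (c : tro_left) x :
  linsub_set V (linsub_val c \oB val x).
Proof.
have := linsubP c.
apply: (@closed_span_sub _ _ _ (preim_linsub (compl _ (val x)) V)).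
  by apply: preim_linsub_closed; exact: tro_closed.
move=> _ [y _ [z _ <-]] /=.
by apply: tro_ternary; exact: linsubP.
Qed.

Lemma tro_right_subproof x (d : tro_right) :
  linsub_set V (val x \oB linsub_val d).
Proof.
have := linsubP d.
apply: (@closed_span_sub _ _ _ (preim_linsub (compr _ (val x)) V)).
  by apply: preim_linsub_closed; exact: tro_closed.
move=> _ [y _ [z _ <-]] /=; rewrite bop_compA.
by apply: tro_ternary; exact: linsubP.
Qed.

Definition tro_lmul (c : tro_left) (x : V) : V := mk_linsub V (tro_left_subproof c x).
Definition tro_rmul (x : V) (d : tro_right) : V := mk_linsub V (tro_right_subproof x d).

Lemma dual_lmul_linear (d : tro_right) (mu : dual V) :
  linear (fun x => mu (tro_rmul x d)).
Proof.
move=> a x y; rewrite -linearP; congr (mu _); apply: val_inj.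
exact: bop_comp_linl.
Qed.

Lemma dual_lmul_bounded (d : tro_right) (mu : dual V) x :
  `|mu (tro_rmul x d)| <= `|mu| * `|d| * `|x|.
Proof.
rewrite (le_trans (bop_ub _ _))// -mulrA ler_wpM2l//.
by rewrite mulrC; exact: bop_comp_norm.
Qed.

(* d . mu = mu (_ d) and mu . c = mu (c _) *)
Definition dual_lmul (d : tro_right) (mu : dual V) : dual V :=
  mk_bop (dual_lmul_linear d mu) (dual_lmul_bounded d mu).

Lemma dual_rmul_linear (mu : dual V) (c : tro_left) :
  linear (fun x => mu (tro_lmul c x)).
Proof.
move=> a x y; rewrite -linearP; congr (mu _); apply: val_inj.
exact: bop_comp_linr.
Qed.

Lemma dual_rmul_bounded (mu : dual V) (c : tro_left) x :
  `|mu (tro_lmul c x)| <= `|mu| * `|c| * `|x|.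
Proof.
rewrite (le_trans (bop_ub _ _))// -mulrA ler_wpM2l//.
exact: bop_comp_norm.
Qed.

Definition dual_rmul (mu : dual V) (c : tro_left) : dual V :=
  mk_bop (dual_rmul_linear mu c) (dual_rmul_bounded mu c).

Lemma dual_bimodE (d : tro_right) (mu : dual V) (c : tro_left) x :
  dual_rmul (dual_lmul d mu) c x = mu (tro_rmul (tro_lmul c x) d).
Proof. by []. Qed.

Definition is_subbimodule (S : set (dual V)) : Prop :=
  [/\ submod_closed (mem S),
      forall d mu, S mu -> S (dual_lmul d mu) &
      forall mu c, S mu -> S (dual_rmul mu c)].

End tro_theory.

Record isometric_iso (R : realType) (E F : normedModType R[i]) := IsometricIso {
  iso_fun :> {linear E -> F};
  iso_norm : forall x, `|iso_fun x| = `|x|;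
  iso_surj : forall y, exists x, iso_fun x = y
}.

Section predual.
Context (R : realType) (E : normedModType R[i]) (P : completeNormedModType R[i]).
Context (phi : isometric_iso E (dual P)).

Lemma predual_emb_linear (p : P) : linear (fun x => phi x p).
Proof. by move=> a x y; rewrite linearP. Qed.

Lemma predual_emb_bounded (p : P) x : `|phi x p| <= `|p| * `|x|.
Proof. by rewrite (le_trans (bop_ub _ _))// iso_norm mulrC. Qed.

(* the canonical map P -> P^** followed by the transpose of phi *)
Definition predual_emb (p : P) : dual E :=
  mk_bop (predual_emb_linear p) (predual_emb_bounded p).

(* initial topology for the functionals [fun x => phi x p], p : P *)
Definition weak_star : Type :=
  initial_topology (fun x : E => (fun p => phi x p) : {ptws P -> R[i]^o}).

HB.instance Definition _ := Topological.on weak_star.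

End predual.

(* The algebra need not be unital. *)
Record is_cstar_algebra (R : realType) (A : normedModType R[i])
    (mul : A -> A -> A) (star : A -> A) : Prop := {
  cstar_mulA : associative mul;
  cstar_mull : forall y, linear (mul^~ y);
  cstar_mulr : forall x, linear (mul x);
  cstar_starK : involutive star;
  cstar_starD : {morph star : x y / x + y};
  cstar_starZ : forall (a : R[i]) x, star (a *: x) = a^* *: star x;
  cstar_starM : forall x y, star (mul x y) = mul (star y) (star x);
  cstar_normM : forall x y, `|mul x y| <= `|x| * `|y|;
  cstar_norm : forall x, `|mul (star x) x| = `|x| ^+ 2;
  cstar_complete : forall F : set_system A, ProperFilter F -> cauchy F -> cvg F
}.

Definition is_wstar_algebra (R : realType) (A : normedModType R[i])
    (mul : A -> A -> A) (star : A -> A) : Prop :=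
  is_cstar_algebra mul star /\
  exists P : completeNormedModType R[i], inhabited (isometric_iso A (dual P)).

(* isometric on the orthogonal complement of its kernel *)
Definition partial_isometry (R : realType) (K H : hilbertType R) (r : bop K H) :=
  forall u : K, (forall v, r v = 0 -> inner u v = 0) -> `|r u| = `|u|.

Section corner.
Context (R : realType) (K H : hilbertType R) (V : tro K H) (r : V).

Let val (x : V) : bop K H := linsub_val x.
Let r0 : bop K H := linsub_val r.

(* V_(r), as a subspace of the normed space V rather than of [bop K H] *)
Definition corner_set : set V :=
  [set x | r0 \oB adjoint r0 \oB val x = val x /\
           val x \oB adjoint r0 \oB r0 = val x].

Lemma corner_subproof : submod_closed (mem corner_set).
Proof.
split.
  rewrite inE; split; apply: bop_ext => u /=; by rewrite ?linear0.
move=> a x y; rewrite !inE => -[x1 x2] [y1 y2]; split.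
  by rewrite bop_comp_linr x1 y1.
by rewrite -bop_compA bop_comp_linl !bop_compA x2 y2.
Qed.

Definition corner : linsub V := LinSub corner_subproof.

Let cval (x : corner) : V := linsub_val x.

Lemma corner_mul_subproof1 (x y : corner) :
  linsub_set V (val (cval x) \oB adjoint r0 \oB val (cval y)).
Proof. by apply: tro_ternary; exact: linsubP. Qed.

Lemma corner_mul_subproof2 (x y : corner) :
  corner_set (mk_linsub V (corner_mul_subproof1 x y)).
Proof.
have [x1 x2] := linsubP x; have [y1 y2] := linsubP y.
split; rewrite /val /=.
  by rewrite !bop_compA x1.
by rewrite -!bop_compA in y2 *; rewrite y2.
Qed.

(* x r^* y *)
Definition corner_mul (x y : corner) : corner := mk_linsub corner (corner_mul_subproof2 x y).

Lemma corner_star_subproof1 (x : corner) :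
  linsub_set V (r0 \oB adjoint (val (cval x)) \oB r0).
Proof. by apply: tro_ternary; exact: linsubP. Qed.

Lemma corner_star_subproof2 (x : corner) :
  corner_set (mk_linsub V (corner_star_subproof1 x)).
Proof.
have [x1 x2] := linsubP x.
have {}x1 := congr1 (@adjoint _ _ _) x1; have {}x2 := congr1 (@adjoint _ _ _) x2.
rewrite !adjoint_comp !adjointK in x1 x2.
split; rewrite /val /=.
  by apply: bop_ext => u /=; congr (r0 _); exact: (congr1 (fun f : bop H K => f (r0 u)) x2).
by apply: bop_ext => u /=; congr (r0 _); exact: (congr1 (fun f : bop H K => f (r0 u)) x1).
Qed.

(* r x^* r *)
Definition corner_star (x : corner) : corner := mk_linsub corner (corner_star_subproof2 x).

End corner.

(* Main.v *)
(* Multiplication by c in C (or d in D) is shown to be weak*-continuous; the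
   bimodule property is its dual statement, and V_(r) is the range of the
   weak*-continuous contractive idempotent x |-> rr^*xr^*r.

   It suffices to treat an operator T on V that is self-adjoint for the forms
   Re <x u, y u> (left multiplication) or Re <x^* v, y^* v> (right
   multiplication).  Let z be the weak* limit of T x_j for a bounded net with
   weak* limit 0; the claim is z = 0.  In place of a net we use a functional G
   on V^* annihilating V_*, obtained from Hahn-Banach, since V_* is norm-closed
   in V^*.  If z' is the weak* limit of A x_j with |x_j| <= 1, then the lower
   semicontinuity of the norm gives, for u in V and s > 0,
     |u + s (z' - A A^* u / 2)|^2 <= |u|^2 + s + O(s^2),
   because |u + s (A x - A A^* u / 2)|^2 <= |u|^2 + s |x|^2 + O(s^2) pointwise.
   Taking u proportional to p^* p z' yields |p^* p z'| = O(|p A|) for |p| = O(1).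
   Apply this to A = U - w^-j, where U = 1 + isT - s^2 T^2 / 2 is almost unitary,
   w is a primitive 2N-th root of unity and p = p_j is the average of the first
   N powers of w^j U, so that |p_j A| = O(1/N).  The limit z' = lim U x_k does not
   depend on j since lim x_k = 0.  Orthogonality over j gives
   |z'|^2 = O(sum_j |p_j^* p_j z'|^2) = O(1/N); with N = s^-4 and
   z' = is z + O(s^2) this forces |z| = O(s). *)
Require Import Defs.
From HB Require Import structures.
From mathcomp Require Import all_boot all_order all_algebra.
From mathcomp Require Import complex.
From mathcomp Require Import boolp classical_sets functions reals topology normedtype.
From mathcomp Require Import interval_inference sequences cyclic separable cyclotomic.
From mathcomp Require Import ring lra.

Set Implicit Arguments.
Unset Strict Implicit.
Unset Printing Implicit Defensive.

Import Order.TTheory GRing.Theory Num.Theory.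
Import numFieldNormedType.Exports.

Local Open Scope classical_set_scope.
Local Open Scope complex_scope.
Local Open Scope ring_scope.

(** * The Hahn-Banach theorem *)

Section sublinear.
Context (R : realType) (V : lmodType R[i]).
Implicit Types (p q : V -> R) (x y : V).

Definition sublinear q :=
  (forall x y, q (x + y) <= q x + q y) /\
  (forall (r : R) x, 0 <= r -> q (r%:C *: x) <= r * q x).

Lemma sublinear0 q : sublinear q -> q 0 = 0.
Proof.
move=> [qD qZ]; apply/eqP; rewrite eq_le; apply/andP; split.
  by have := qZ 0 0 (lexx _); rewrite scaler0 mul0r.
by have := qD 0 0; rewrite addr0 -subr_ge0 addrK.
Qed.

Lemma sublinear_lb q x : sublinear q -> - q (- x) <= q x.
Proof.
move=> sq; have [qD _] := sq.
by have := qD x (- x); rewrite subrr (sublinear0 sq); lra.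
Qed.

(** Sublinear and below [q], with value at most [- q y] at [- y] (take [t = 1]): a sublinear
    functional below it is forced up to at least [q y] at [y]. *)
Definition tilt q y x : R :=
  inf [set q (x + t%:C *: y) - t * q y | t in [set t : R | 0 <= t]].

Lemma tilt_le q y x (t : R) : sublinear q -> 0 <= t ->
  tilt q y x <= q (x + t%:C *: y) - t * q y.
Proof.
move=> sq t0; have [qD qZ] := sq; apply: ge_inf; last by exists t.
(* A lower bound uniform in [s], by subadditivity on [s y = (x + s y) - x]; without it [inf] would
   only be a default value. *)
exists (- q (- x)) => _ [s /= s0 <-].
suff : s * q y <= q (x + s%:C *: y) + q (- x) by lra.
have [->|s1] := eqVneq s 0.
  rewrite mul0r scale0r addr0; have := sublinear_lb x sq; lra.
have sp : 0 < s by rewrite lt_def s1.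
have -> : q y = q (s^-1%:C *: (s%:C *: y)).
  by rewrite scalerA -rmorphM /= mulVf// scale1r.
have : q (s^-1%:C *: (s%:C *: y)) <= s^-1 * q (s%:C *: y) by apply: qZ; rewrite invr_ge0.
rewrite ler_pdivlMl// => /le_trans; apply.
by have := qD (x + s%:C *: y) (- x); rewrite addrAC subrr add0r.
Qed.

Lemma le_tilt q y x c :
  (forall t : R, 0 <= t -> c <= q (x + t%:C *: y) - t * q y) -> c <= tilt q y x.
Proof.
move=> h; apply: lb_le_inf; first by exists (q (x + 0%:C *: y) - 0 * q y), 0 => /=.
by move=> _ [t /= t0 <-]; apply: h.
Qed.

Lemma tilt_le_id q y x : sublinear q -> tilt q y x <= q x.
Proof. by move=> /tilt_le - /(_ y x 0 (lexx _)); rewrite scale0r addr0 mul0r subr0. Qed.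

Lemma tilt_sublinear q y : sublinear q -> sublinear (tilt q y).
Proof.
move=> sq; have [qD qZ] := sq; split=> [x1 x2|r x r0].
  rewrite -lerBlDr; apply: le_tilt => s s0; rewrite lerBlDr -lerBlDl.
  apply: le_tilt => t t0; rewrite lerBlDl.
  apply: le_trans (tilt_le _ _ sq (addr_ge0 s0 t0)) _.
  have := qD (x1 + s%:C *: y) (x2 + t%:C *: y).
  rewrite addrACA -scalerDl -rmorphD /=; lra.
have [->|r1] := eqVneq r 0.
  by rewrite scale0r mul0r -(sublinear0 sq) tilt_le_id.
have rp : 0 < r by rewrite lt_def r1.
rewrite -ler_pdivrMl//; apply: le_tilt => t t0; rewrite ler_pdivrMl//.
apply: le_trans (tilt_le _ _ sq (mulr_ge0 r0 t0)) _.
rewrite rmorphM /= -scalerA -scalerDr mulrBr mulrA lerD2r.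
exact: qZ.
Qed.

(** The pointwise infimum works. For subadditivity the chain condition supplies one member that lies
    below both of two given ones. *)
Lemma inf_chain_sublinear p (A : set (V -> R)) : sublinear p -> A !=set0 ->
  (forall q, A q -> sublinear q /\ forall x, q x <= p x) ->
  (forall q1 q2, A q1 -> A q2 -> (forall x, q1 x <= q2 x) \/ (forall x, q2 x <= q1 x)) ->
  exists2 m, sublinear m & forall q, A q -> forall x, m x <= q x.
Proof.
move=> sp A0 Ap Ach; pose m x := inf [set q x | q in A].
have mle q x : A q -> m x <= q x.
  move=> Aq; apply: ge_inf; last by exists q.
  exists (- p (- x)) => _ [q' /Ap[sq' q'p] <-].
  by apply: le_trans (sublinear_lb _ sq'); rewrite lerN2.
have lem x c : (forall q, A q -> c <= q x) -> c <= m x.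
  move=> h; apply: lb_le_inf; first by have [q Aq] := A0; exists (q x), q.
  by move=> _ [q Aq <-]; apply: h.
exists m => //; last by move=> q Aq x; apply: mle.
split=> [x y|r x r0].
  suff h q1 : A q1 -> m (x + y) - q1 x <= m y.
    by rewrite -lerBlDr; apply: (lem) => q1 /h; rewrite lerBlDr lerBlDl.
  move=> A1; apply: (lem) => q2 A2; rewrite lerBlDl.
  have [q [Aq h1 h2]] : exists q, [/\ A q, q x <= q1 x & q y <= q2 y].
    by case: (Ach _ _ A1 A2) => h; [exists q1|exists q2]; split.
  by apply: le_trans (mle _ _ Aq) _; apply: le_trans ((Ap _ Aq).1.1 _ _) (lerD h1 h2).
have [->|r1] := eqVneq r 0.
  rewrite scale0r mul0r; have [q Aq] := A0.
  by rewrite -(sublinear0 (Ap _ Aq).1) mle.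
have rp : 0 < r by rewrite lt_def r1.
rewrite -ler_pdivrMl//; apply: (lem) => q Aq; rewrite ler_pdivrMl//.
exact: le_trans (mle _ _ Aq) ((Ap _ Aq).1.2 _ _ r0).
Qed.

(** Zorn's lemma for the reversed pointwise order; the empty chain is bounded by [p] itself. *)
Lemma minimal_sublinear p : sublinear p ->
  exists q, [/\ sublinear q, forall x, q x <= p x &
    forall q', sublinear q' -> (forall x, q' x <= q x) -> q' = q].
Proof.
move=> sp; pose T := {q | sublinear q /\ forall x, q x <= p x}.
pose ge_ : rel T := fun s t => `[< forall x, sval t x <= sval s x >].
have [|||A tA|[q [sq qp]] qmin] := @Zorn T ge_.
- by move=> s; apply/asboolP.
- by move=> s t u /asboolP st /asboolP tu; apply/asboolP => x; apply: le_trans (tu x) (st x).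
- move=> [s sP] [t tP] /asboolP st /asboolP ts; apply: eq_exist => /=.
  by apply/funext => x; apply/eqP; rewrite eq_le (st x) (ts x).
- have [->|/set0P[q0 Aq0]] := eqVneq A set0.
    by exists (exist _ p (conj sp (fun=> lexx _))).
  have [|||m sm mA] := @inf_chain_sublinear p (sval @` A) sp.
  + by exists (sval q0), q0.
  + by move=> _ [q _ <-]; exact: svalP q.
  + move=> _ _ [q1 A1 <-] [q2 A2 <-].
    by case: (tA _ _ A1 A2) => /asboolP h; [right|left].
  have mp x : m x <= p x.
    by apply: le_trans ((svalP q0).2 x); apply: mA; exists q0.
  exists (exist _ m (conj sm mp)) => q Aq; apply/asboolP => x /=.
  by apply: mA; exists q.
exists q; split=> // q' sq' q'q.
have q'p x : q' x <= p x by apply: le_trans (q'q x) (qp x).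
have /(_ _)/(congr1 sval) := qmin (exist _ q' (conj sq' q'p)); apply.
exact/asboolP.
Qed.

Definition real_linear (f : V -> R) :=
  (forall x y, f (x + y) = f x + f y) /\ forall (r : R) x, f (r%:C *: x) = r * f x.

(* A minimal sublinear functional equals each of its tilts, hence is superadditive. *)
Lemma minimal_sublinear_linear q : sublinear q ->
  (forall q', sublinear q' -> (forall x, q' x <= q x) -> q' = q) -> real_linear q.
Proof.
move=> sq qmin; have [qD qZ] := sq.
have qA x y : q (x + y) = q x + q y.
  apply/eqP; rewrite eq_le qD /= -lerBrDr.
  have <- : tilt q y = q by apply: qmin => [|z]; [exact: tilt_sublinear|exact: tilt_le_id].
  have := tilt_le y x sq (ler01 : 0 <= (1 : R)); rewrite scale1r mul1r.
  have -> // : tilt q y = q by apply: qmin => [|z]; [exact: tilt_sublinear|exact: tilt_le_id].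
have qN x : q (- x) = - q x.
  by apply/eqP; rewrite -addr_eq0 -qA addNr (sublinear0 sq).
have qZ0 (r : R) x : 0 <= r -> q (r%:C *: x) = r * q x.
  move=> r0; apply/eqP; rewrite eq_le qZ//=.
  by have := qZ r (- x) r0; rewrite scalerN !qN mulrN lerN2.
split=> // r x; have [r0|r0] := leP 0 r; first exact: qZ0.
have := qZ0 (- r) x; rewrite rmorphN scaleNr qN mulNr => /(_ _)/oppr_inj; apply.
by rewrite oppr_ge0 ltW.
Qed.

(** Take a minimal functional below the tilt of [p] along [e]: it is linear, and its value at [- e]
    is at most [- p e]. *)
Lemma Hahn_Banach_sublinear p e : sublinear p ->
  exists f, [/\ real_linear f, forall x, f x <= p x & f e = p e].
Proof.
move=> sp; have [q [sq qp qmin]] := minimal_sublinear (tilt_sublinear e sp).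
have ql := minimal_sublinear_linear sq qmin.
have qlep x : q x <= p x by apply: le_trans (qp x) (tilt_le_id _ _ sp).
exists q; split=> //; apply/eqP; rewrite eq_le qlep /=.
have := qp (- e); have := tilt_le e (- e) sp (ler01 : 0 <= (1 : R)).
rewrite scale1r mul1r addNr (sublinear0 sp).
have := sublinear_lb e sq; lra.
Qed.

End sublinear.

(** * Real-valued norms and phases *)

Section rnorm.
Context (R : realType).
Implicit Types E F : normedModType R[i].

Definition rnorm E (x : E) : R := complex.Re `|x|.

Lemma rnormE E (x : E) : (rnorm x)%:C = `|x|. Proof. exact: Re_norm. Qed.

Lemma rnorm_le E F (x : E) (y : F) : (rnorm x <= rnorm y) = (`|x| <= `|y|).
Proof. by rewrite -!rnormE lecR. Qed.

Lemma rnorm_lec E (x : E) (c : R) : (rnorm x <= c) = (`|x| <= c%:C).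
Proof. by rewrite -rnormE lecR. Qed.

Lemma rnorm_ge0 E (x : E) : 0 <= rnorm x.
Proof. by rewrite -lecR rnormE normr_ge0. Qed.

Lemma rnormD E (x y : E) : rnorm (x + y) <= rnorm x + rnorm y.
Proof. by rewrite rnorm_lec rmorphD /= !rnormE ler_normD. Qed.

Lemma rnormN E (x : E) : rnorm (- x) = rnorm x.
Proof. by rewrite /rnorm normrN. Qed.

Lemma rnormZ E (a : R[i]) (x : E) : rnorm (a *: x) = rnorm (a : R[i]^o) * rnorm x.
Proof. by apply: complexI; rewrite rmorphM /= !rnormE normrZ. Qed.

Lemma rnorm_real (r : R) : rnorm (r%:C : R[i]^o) = `|r|.
Proof. by rewrite /rnorm /= expr0n addr0 sqrtr_sqr. Qed.

Lemma rnormZr E (r : R) (x : E) : rnorm (r%:C *: x) = `|r| * rnorm x.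
Proof. by rewrite rnormZ rnorm_real. Qed.

Lemma rnorm0 E : rnorm (0 : E) = 0.
Proof. by rewrite /rnorm normr0. Qed.

Lemma rnorm0_eq0 E (x : E) : rnorm x <= 0 -> x = 0.
Proof. by rewrite rnorm_lec normr_le0 => /eqP. Qed.

Lemma rnorm_bop E F (f : bop E F) x : rnorm (f x) <= rnorm f * rnorm x.
Proof. by rewrite rnorm_lec rmorphM /= !rnormE bop_ub. Qed.

Lemma rnorm_comp E F (G : normedModType R[i]) (f : bop F G) (g : bop E F) :
  rnorm (f \oB g) <= rnorm f * rnorm g.
Proof. by rewrite rnorm_lec rmorphM /= !rnormE bop_comp_norm. Qed.

Lemma rnorm_bop_le E F (f : bop E F) (M : R) : 0 <= M ->
  (forall x, rnorm x <= 1 -> rnorm (f x) <= M) -> rnorm f <= M.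
Proof.
move=> M0 h; rewrite rnorm_lec; apply: bop_le => [|x]; first by rewrite lecR.
have [->|x0] := eqVneq x 0; first by rewrite linear0 !normr0 mulr0.
have r0 : 0 < rnorm x.
  by rewrite lt_def rnorm_ge0 andbT; apply: contra_neq x0 => x0; apply: rnorm0_eq0; rewrite x0.
rewrite -!rnormE -rmorphM lecR -ler_pdivrMr// mulrC.
have -> : (rnorm x)^-1 = `|(rnorm x)^-1| by rewrite ger0_norm// invr_ge0 ltW.
rewrite -rnormZr -linearZ; apply: h.
by rewrite rnormZr ger0_norm ?invr_ge0 ?(ltW r0)// mulVf// gt_eqF.
Qed.

Lemma phase (z : R[i]) :
  exists2 u : R[i], `|u| = 1 & u * z = `|z|.
Proof.
have [->|z0] := eqVneq z 0; first by exists 1; rewrite ?normr1// mulr0 normr0.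
exists (z^* / `|z|); first by rewrite normrM normfV normr_id norm_conjC mulfV// normr_eq0.
by rewrite mulrAC [_ * z]mulrC -normCK expr2 mulfK// normr_eq0.
Qed.

Lemma rnorm_unit (u : R[i]) : `|u| = 1 -> rnorm (u : R[i]^o) = 1.
Proof. by move=> u1; apply: complexI; rewrite rnormE; exact: u1. Qed.

Lemma Re_le_rnorm (z : R[i]) : complex.Re z <= rnorm (z : R[i]^o).
Proof.
case: z => a b; rewrite /rnorm /=.
by apply: le_trans (ler_norm a) _; rewrite -sqrtr_sqr ler_sqrt ?addr_ge0 ?sqr_ge0// lerDl sqr_ge0.
Qed.

End rnorm.

Section complexify.
Context (R : realType) (E : normedModType R[i]) (f : E -> R).
Hypotheses (fl : real_linear f) (fle : forall x, f x <= rnorm x).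

(** The only complex-linear functional with real part [f]. *)
Let g (x : E) : R[i]^o := (f x)%:C - 'i * (f ('i *: x))%:C.

Let Re_g x : complex.Re (g x) = f x.
Proof. by rewrite /g /= !(mul0r, mul1r, mulr0, subr0, oppr0, addr0). Qed.

Let gD x y : g (x + y) = g x + g y.
Proof. by rewrite /g scalerDr !fl.1 !rmorphD /=; ring. Qed.

Let gr (r : R) x : g (r%:C *: x) = r%:C * g x.
Proof. by rewrite /g scalerA [_ * r%:C]mulrC -scalerA !fl.2 !rmorphM /=; ring. Qed.

Let fN x : f (- x) = - f x.
Proof. by rewrite -scaleN1r -(rmorphN1 (real_complex R)) fl.2 mulN1r. Qed.

Let gi x : g ('i *: x) = 'i * g x.
Proof.
by rewrite /g scalerA -expr2 sqr_i scaleN1r fN rmorphN mulrBr mulrA -expr2 sqr_i; ring.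
Qed.

Let gZ a x : g (a *: x) = a * g x.
Proof.
by rewrite [a]complexE scalerDl gD -scalerA gi !gr mulrA mulrDl.
Qed.

Let g_linear : linear g.
Proof. by move=> a x y; rewrite gD gZ. Qed.

Let g_bounded x : `|g x| <= 1 * `|x|.
Proof.
(* Rotating [x] makes the value of [g] equal to [|g x|], hence to its own real part, which [f]
   controls. *)
rewrite mul1r -rnorm_le; have [u u1 ux] := phase (g x).
have := fle (u *: x); rewrite -Re_g gZ rnormZ ux.
by rewrite (rnorm_unit u1) mul1r.
Qed.

Lemma complexify : exists2 g : dual E, (forall x, rnorm (g x) <= rnorm x) &
  forall x, complex.Re (g x) = f x.
Proof.
exists (mk_bop g_linear g_bounded) => x; last exact: Re_g.
by rewrite rnorm_le -[leRHS]mul1r g_bounded.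
Qed.

End complexify.

Section hahn_banach_normed.
Context (R : realType) (E : normedModType R[i]).

(** The distance [p] to [S] is sublinear. A real functional below [p] is nonpositive on [S]; since
    [S] is stable under phases, its complexification vanishes there. *)
Lemma Hahn_Banach_dist (S : linsub E) (e : E) (d : R) :
  (forall s, linsub_set S s -> d <= rnorm (e - s)) ->
  exists g : dual E, [/\ forall x, rnorm (g x) <= rnorm x,
    forall s, linsub_set S s -> g s = 0 & d <= complex.Re (g e)].
Proof.
move=> hd; have [S0 SD] := linsub_closed S.
have {}S0 : linsub_set S 0 by rewrite inE in S0.
have {}SD a x y : linsub_set S x -> linsub_set S y -> linsub_set S (a *: x + y).
  by move=> Sx Sy; have := SD a x y; rewrite !inE; apply.
pose p x : R := inf [set rnorm (x - s) | s in linsub_set S].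
have ple x s : linsub_set S s -> p x <= rnorm (x - s).
  move=> Ss; apply: ge_inf; last by exists s.
  by exists 0 => _ [t _ <-]; exact: rnorm_ge0.
have lep x c : (forall s, linsub_set S s -> c <= rnorm (x - s)) -> c <= p x.
  move=> h; apply: lb_le_inf; first by exists (rnorm (x - 0)), 0.
  by move=> _ [s Ss <-]; apply: h.
have sp : sublinear p.
  split=> [x y|r x r0].
    rewrite -lerBlDr; apply: (lep) => s Ss; rewrite lerBlDr -lerBlDl.
    apply: (lep) => t St; rewrite lerBlDl.
    have Sst : linsub_set S (s + t) by rewrite -[s]scale1r; apply: SD.
    apply: le_trans (ple _ _ Sst) _.
    by rewrite opprD addrACA rnormD.
  have [->|r1] := eqVneq r 0.
    by rewrite scale0r mul0r; apply: le_trans (ple _ _ S0) _; rewrite subr0 rnorm0.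
  have rp : 0 < r by rewrite lt_def r1.
  rewrite -ler_pdivrMl//; apply: (lep) => s Ss; rewrite ler_pdivrMl//.
  have Srs : linsub_set S (r%:C *: s) by rewrite -[_ *: s]addr0; apply: SD.
  by apply: le_trans (ple _ _ Srs) _; rewrite -scalerBr rnormZr ger0_norm.
have [f [fl fp fe]] := Hahn_Banach_sublinear e sp.
have fle x : f x <= rnorm x.
  by apply: le_trans (fp x) _; apply: le_trans (ple _ _ S0) _; rewrite subr0.
have [g g1 gf] := complexify fl fle.
have Re0 s : linsub_set S s -> complex.Re (g s) <= 0.
  by move=> Ss; rewrite gf; apply: le_trans (fp s) _; apply: le_trans (ple _ _ Ss) _; rewrite subrr rnorm0.
exists g; split=> // [s Ss|]; last by rewrite gf fe; apply: (lep).
have [u u1 ux] := phase (g s).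
have Sus : linsub_set S (u *: s) by rewrite -[_ *: s]addr0; apply: SD.
have gus : g (u *: s) = u * g s by rewrite linearZ.
by apply: rnorm0_eq0; have := Re0 _ Sus; rewrite gus ux.
Qed.

Lemma linsub0_subproof : submod_closed (mem [set (0 : E)]).
Proof.
by split=> [|a x y]; rewrite !inE//= => -> ->; rewrite scaler0 addr0.
Qed.
Definition linsub0 : linsub E := LinSub linsub0_subproof.

Lemma norming_functional (e : E) :
  exists2 g : dual E, (forall x, rnorm (g x) <= rnorm x) & rnorm e <= rnorm (g e).
Proof.
have [s ->|g [g1 _ ge]] := @Hahn_Banach_dist linsub0 e (rnorm e); first by rewrite subr0.
by exists g => //; apply: le_trans ge (Re_le_rnorm _).
Qed.

End hahn_banach_normed.

(** * Weak* limits and self-adjoint operators *)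

(* Modelled on the forms Re <J_i x, J_i y> for evaluations J_i into a Hilbert
   space; [nf_conj] is phrased to hold for J_i linear (x |-> x u) as well as
   conjugate-linear (x |-> x^* v). *)
Record norming_forms (R : realType) (V : normedModType R[i]) := NormingForms {
  nf_index : Type;
  nf_form :> nf_index -> V -> V -> R;
  nf_sym : forall i x y, nf_form i x y = nf_form i y x;
  nf_addl : forall i x y z, nf_form i (x + y) z = nf_form i x z + nf_form i y z;
  nf_scalel : forall i (r : R) x y, nf_form i (r%:C *: x) y = r * nf_form i x y;
  nf_conj : forall i (a : R[i]) x y, nf_form i (a *: x) y = nf_form i x (a^* *: y);
  nf_ge0 : forall i x, 0 <= nf_form i x x;
  nf_le : forall i x, nf_form i x x <= rnorm x ^+ 2;
  nf_sup : forall x (e : R), 0 < e -> exists i, rnorm x ^+ 2 - e <= nf_form i x x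
}.

Section norming_forms.
Context (R : realType) (V : normedModType R[i]) (b : norming_forms V).
Implicit Types (i : nf_index b) (x y z u : V).

Let q i x : R := b i x x.

Lemma nf_addr i x y z : b i z (x + y) = b i z x + b i z y.
Proof. by rewrite nf_sym nf_addl !(nf_sym i z). Qed.

Lemma nf_scaler i (r : R) x y : b i y (r%:C *: x) = r * b i y x.
Proof. by rewrite nf_sym nf_scalel nf_sym. Qed.

Lemma nf_oppl i x y : b i (- x) y = - b i x y.
Proof. by rewrite -scaleN1r -(rmorphN1 (real_complex R)) nf_scalel mulN1r. Qed.

Lemma nf_oppr i x y : b i y (- x) = - b i y x.
Proof. by rewrite nf_sym nf_oppl nf_sym. Qed.

Lemma nf_0l i x : b i 0 x = 0.
Proof. by rewrite -(scale0r 0) -(rmorph0 (real_complex R)) nf_scalel mul0r. Qed.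

Lemma nf_0r i x : b i x 0 = 0.
Proof. by rewrite nf_sym nf_0l. Qed.

Definition nf_bilin := (nf_addl, nf_addr, nf_scalel, nf_scaler, nf_oppl, nf_oppr).

Lemma nf_suml i n (F : 'I_n -> V) x : b i (\sum_k F k) x = \sum_k b i (F k) x.
Proof.
elim/big_rec2: _ => [|k r y _ <-]; first by rewrite nf_0l.
by rewrite nf_addl.
Qed.

Lemma nf_sumr i n (F : 'I_n -> V) x : b i x (\sum_k F k) = \sum_k b i x (F k).
Proof. by rewrite nf_sym nf_suml; apply: eq_bigr => k _; rewrite nf_sym. Qed.

Lemma nf_unit i (a : R[i]) x y : `|a| = 1 -> b i (a *: x) (a *: y) = b i x y.
Proof. by move=> a1; rewrite nf_conj scalerA mulrC -normCK a1 expr1n scale1r. Qed.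

Lemma nf_i i x y : b i ('i *: x) y = - b i x ('i *: y).
Proof. by rewrite nf_conj conjCi scaleNr nf_oppr. Qed.

Lemma nf_AMGM i x y (t : R) : 2 * t * b i x y <= t ^+ 2 * q i x + q i y.
Proof.
have := nf_ge0 i (t%:C *: x - y); rewrite !nf_bilin (nf_sym i y x) /q.
lra.
Qed.

Lemma nf_sqrD i x y : q i (x - y) <= 2 * q i x + 2 * q i y.
Proof.
have := nf_ge0 i (x + y); rewrite /q !nf_bilin (nf_sym i y x); lra.
Qed.

(** Each mixed term of the double sum is at most the mean of two diagonal ones, so each diagonal
    term is counted [n] times. *)
Lemma nf_sqr_sum i n (F : 'I_n -> V) :
  q i (\sum_k F k) <= n%:R * \sum_k q i (F k).
Proof.
rewrite /q nf_suml.
have -> : \sum_k b i (F k) (\sum_l F l) = \sum_k \sum_l b i (F k) (F l).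
  by apply: eq_bigr => k _; rewrite nf_sumr.
have h (k l : 'I_n) : b i (F k) (F l) <= (q i (F k) + q i (F l)) / 2.
  by have := nf_AMGM i (F k) (F l) 1; rewrite expr1n !mul1r mulr1; lra.
apply: le_trans (ler_sum _ (fun k _ => ler_sum _ (fun l _ => h k l))) _.
under eq_bigr => k _ do rewrite -mulr_suml big_split /= sumr_const card_ord.
rewrite -mulr_suml big_split /= sumr_const card_ord -sumrMnl.
rewrite -[X in X <= _](_ : n%:R * \sum_k q i (F k) = _)//.
rewrite sumrMnl -mulr_natl; lra.
Qed.

Lemma rnorm_sqr_le x (c : R) : (forall i, q i x <= c) -> rnorm x ^+ 2 <= c.
Proof.
move=> h; rewrite leNgt; apply/negP => cx.
have e0 : 0 < (rnorm x ^+ 2 - c) / 2 by rewrite divr_gt0// subr_gt0.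
have [j] := nf_sup b x e0; have := h j; rewrite /q; lra.
Qed.

Definition nf_adjoint (A A' : V -> V) := forall i x y, b i (A x) y = b i x (A' y).

Lemma nf_adjoint_iter A A' k : nf_adjoint A A' -> nf_adjoint (iter k A) (iter k A').
Proof. by move=> AA'; elim: k => // k IH i x y; rewrite iterS AA' IH -iterSr. Qed.

End norming_forms.

(* What a weak* limit z of A x_j, for a net x_j in the unit ball with weak* limit 0,
   satisfies by lower semicontinuity of the norm. *)
Definition ball_limit (R : realType) (V : normedModType R[i]) (A : V -> V) (z : V) :=
  forall u (M : R), (forall x, rnorm x <= 1 -> rnorm (A x + u) <= M) ->
    rnorm (z + u) <= M.

Lemma le_of_small_slope (R : realType) (a c C : R) :
  (forall s, 0 < s -> s <= 1 -> a <= c + C * s) -> a <= c.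
Proof.
move=> h; rewrite leNgt; apply/negP => ca.
have C1 : 0 < `|C| + 1 by rewrite ltr_wpDl.
pose s := Num.min 1 ((a - c) / 2 / (`|C| + 1)).
have s0 : 0 < s by rewrite lt_min ltr01 !divr_gt0// subr_gt0.
have s1 : s <= 1 by rewrite ge_min lexx.
have s2 : s * (`|C| + 1) <= (a - c) / 2.
  by rewrite -ler_pdivlMr// ge_min lexx orbT.
have := h s s0 s1; have := ler_norm C; have := normr_ge0 C; nra.
Qed.

(** * Semicontinuity of the norm at a limit *)

Section ball_limit.
Context (R : realType) (V : normedModType R[i]) (b : norming_forms V).
Implicit Types (i : nf_index b) (x y z u : V).

Let q i x : R := b i x x.

Lemma ball_limitZ (A : V -> V) z (a : R[i]) : a != 0 ->
  ball_limit A z -> ball_limit (fun x => a *: A x) (a *: z).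
Proof.
move=> a0 Az u M h.
have na : 0 < rnorm (a : R[i]^o).
  by rewrite lt_def rnorm_ge0 andbT; apply: contra_neq a0 => a0; apply: (@rnorm0_eq0 _ R[i]^o); rewrite a0.
have aE x : a *: x + u = a *: (x + a^-1 *: u).
  by rewrite scalerDr scalerA divff// scale1r.
rewrite aE rnormZ mulrC -ler_pdivlMr//; apply: Az => x /h.
by rewrite aE rnormZ mulrC -ler_pdivlMr.
Qed.

(** Completing the square gives [2 b u (A x) - b (A' u) (A' u) <= b x x <= 1] on the unit ball. So
    the correction [A (A' u) / 2] keeps the slope in [s] at most 1 for every [x], and [ball_limit]
    passes the bound on to [z]. [K] collects the terms of order [s ^+ 2]. *)
Lemma ball_limit_sqr (A A' : V -> V) z (c : R) u :
  ball_limit A z -> nf_adjoint b A A' -> (forall x, rnorm (A x) <= c * rnorm x) ->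
  exists K, forall s : R, 0 < s ->
    rnorm (u + s%:C *: (z - 2^-1%:C *: A (A' u))) ^+ 2 <= rnorm u ^+ 2 + s + K * s ^+ 2.
Proof.
move=> Az AA' Ac; pose w := 2^-1%:C *: A (A' u).
exists ((`|c| + rnorm w) ^+ 2) => s s0; set M2 := (X in _ <= X).
have M0 : 0 <= M2.
  apply: addr_ge0; last by apply: mulr_ge0; exact: sqr_ge0.
  by apply: addr_ge0; [exact: sqr_ge0|exact: ltW].
have sq x : (rnorm (x : V) <= Num.sqrt M2) = (rnorm x ^+ 2 <= M2).
  by rewrite -{2}(sqr_sqrtr M0) ler_pXn2r// nnegrE ?rnorm_ge0 ?sqrtr_ge0.
have E v : u + s%:C *: (v - w) = s%:C *: v + (u - s%:C *: w) by rewrite scalerBr addrCA.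
rewrite -sq E.
have s0' : s%:C != 0 :> R[i] by rewrite -(rmorph0 (real_complex R)) (inj_eq (@complexI R)) gt_eqF.
apply: (ball_limitZ s0' Az) => x x1; rewrite -E.
rewrite sq; apply: (rnorm_sqr_le (b := b)) => i.
set y := A x - w.
have qy : q i y <= (`|c| + rnorm w) ^+ 2.
  apply: le_trans (nf_le i y) _; rewrite ler_pXn2r ?nnegrE ?addr_ge0 ?rnorm_ge0//.
  apply: le_trans (rnormD _ _) _; rewrite rnormN lerD2r.
  apply: le_trans (Ac x) _; apply: le_trans (ler_norm _) _.
  by rewrite normrM [`|rnorm x|]ger0_norm ?rnorm_ge0// ler_piMr.
have h1 : 2 * b i u y <= q i x.
  rewrite /y /w !nf_bilin [b i u (A x)]nf_sym [b i u (A _)]nf_sym !AA'.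
  have := nf_AMGM i x (A' u) 1; rewrite expr1n !mulr1 mul1r /q; lra.
have qx : q i x <= 1.
  by apply: le_trans (nf_le i x) _; rewrite expr_le1 ?rnorm_ge0.
have qu := nf_le i u.
clearbody y; rewrite !nf_bilin (nf_sym i y u) /M2.
move: qy h1 qx qu; rewrite /q; nra.
Qed.

End ball_limit.

(** * Averages of the powers of an operator *)

Section iterate_average.
Context (R : realType) (V : normedModType R[i]).
Implicit Types (W : {linear V -> V}) (x y z : V).

Definition iter_avg (W : V -> V) N x : V := (N%:R^-1)%:C *: \sum_(k < N) iter k W x.

Lemma iter_avgZ W N a x : iter_avg W N (a *: x) = a *: iter_avg W N x.
Proof.
rewrite /iter_avg scalerA mulrC -scalerA; congr (_ *: _); rewrite scaler_sumr.
apply: eq_bigr => k _; elim: (k : nat) => // l IH.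
by rewrite !iterS IH linearZ.
Qed.

Lemma iter_avg_telescope W N x :
  W (iter_avg W N x) - iter_avg W N x = (N%:R^-1)%:C *: (iter N W x - x).
Proof.
rewrite /iter_avg linearZ -scalerBr linear_sum; congr (_ *: _).
elim: N => [|N IH]; first by rewrite !big_ord0 !subrr.
by rewrite !big_ord_recr /= opprD addrACA IH addrC addrA subrK.
Qed.

Context (b : norming_forms V).
Let q (i : nf_index b) x : R := b i x x.

Lemma iter_avg_adjoint W W' N : nf_adjoint b W W' ->
  nf_adjoint b (iter_avg W N) (iter_avg W' N).
Proof.
move=> WW' i x y; rewrite /iter_avg nf_scalel nf_scaler nf_suml nf_sumr.
by congr (_ * _); apply: eq_bigr => k _; rewrite (nf_adjoint_iter k WW').
Qed.

Lemma iter_avg_sqr_le W N i x : (0 < N)%N ->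
  (forall k, (k <= N)%N -> q i (iter k W x) <= 2 * q i x) ->
  q i (iter_avg W N x) <= 2 * q i x.
Proof.
move=> N0 h; rewrite /q /iter_avg !nf_bilin -/(q i _).
have n0 : 0 < N%:R :> R by rewrite ltr0n.
rewrite !ler_pdivrMl//; apply: (le_trans (nf_sqr_sum i (fun k : 'I_N => iter k W x))).
rewrite ler_pM2l//.
apply: (@le_trans _ _ (\sum_(k < N) 2 * q i x)).
  by apply: ler_sum => k _; apply: h; rewrite ltnW.
by rewrite sumr_const card_ord -[X in X <= _]mulr_natl.
Qed.

(* Test the limit z of (W - 1) x_j against u = (N^2/6) p' p z with p the average
   of the powers of W: (W' - 1) p' has norm O(1/N). *)
Lemma ball_limit_iter_avg W W' N z : (0 < N)%N -> nf_adjoint b W W' ->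
  (forall i x k, (k <= N)%N -> q i (iter k W x) <= 2 * q i x) ->
  (forall i x k, (k <= N)%N -> q i (iter k W' x) <= 2 * q i x) ->
  ball_limit (fun x => W x - x) z ->
  rnorm (iter_avg W' N (iter_avg W N z)) ^+ 2 <= 12 / N%:R ^+ 2.
Proof.
move=> N0 WW' qW qW' lz.
have n0 : 0 < N%:R :> R by rewrite ltr0n.
have W'W : nf_adjoint b W' W by move=> i x y; rewrite nf_sym -WW' nf_sym.
pose A x := W x - x; pose A' x := W' x - x.
have AA' : nf_adjoint b A A' by move=> i x y; rewrite !nf_bilin WW'.
(* The value 3 is immaterial: it only enters [K], whose term disappears as [s] tends to 0. *)
have Ac x : rnorm (A x) <= 3 * rnorm x.
  have h : rnorm (W x) <= 2 * rnorm x.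
    rewrite -(@ler_pXn2r _ 2)// ?nnegrE ?mulr_ge0 ?rnorm_ge0//.
    apply: (rnorm_sqr_le (b := b)) => i; have := qW i x 1 N0.
    have := nf_le i x; rewrite /q /= exprMn; have := nf_ge0 i x; nra.
  by apply: le_trans (rnormD _ _) _; rewrite rnormN; lra.
set y := iter_avg W N z; set v := iter_avg W' N y.
(* The form of [W'^N y - y] is at most [6 = 2 * 2 + 2] times that of [y]. With this [kap] the loss
   [b (A' u) (A' u)] is at most [kap * q i y], half of the gain [2 b u z]. *)
pose kap : R := N%:R ^+ 2 / 6.
have kap0 : 0 < kap by rewrite divr_gt0// exprn_gt0.
pose u := kap%:C *: v.
have [K hK] := ball_limit_sqr u lz AA' Ac.
suff hu : rnorm u ^+ 2 <= 2 * kap.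
  have : kap * (kap * rnorm v ^+ 2) <= kap * 2.
    move: hu; rewrite /u rnormZr gtr0_norm// exprMn; lra.
  rewrite ler_pM2l// /kap mulrAC ler_pdivrMr// mulrC -ler_pdivlMr ?exprn_gt0//.
  by rewrite [2 * 6](_ : _ = 12) //; ring.
apply: (le_of_small_slope (C := 2 * kap * (`|K| + 1) + 1)) => s s0 s1.
(* The form may depend on [s]: it attains the norm of [u] up to [s ^+ 2], so that [hK] bounds the
   slope [2 b u t] by [1 + O(s)]. *)
have [i hi] := nf_sup b u (exprn_gt0 2 s0).
have := le_trans (nf_le i _) (hK s s0).
set t := z - _ => ht.
have ut : 2 * b i u t = 2 * b i u z - b i (A' u) (A' u).
  by rewrite /t nf_addr nf_oppr nf_scaler [b i u (A _)]nf_sym AA'; lra.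
have A'u : b i (A' u) (A' u) <= kap * q i y.
  have -> : A' u = (kap / N%:R)%:C *: (iter N W' y - y).
    rewrite /A' /u linearZ -scalerBr iter_avg_telescope scalerA -rmorphM /=.
    by rewrite -/y.
  have h : b i (iter N W' y - y) (iter N W' y - y) <= 6 * q i y.
    have := nf_sqrD i (iter N W' y) y; have := qW' i y N (leqnn _); rewrite /q; lra.
  rewrite nf_scalel nf_scaler.
  have k6 : (kap / N%:R) ^+ 2 * 6 = kap by rewrite /kap; field; rewrite gt_eqF.
  have := ler_wpM2l (sqr_ge0 (kap / N%:R)) h; rewrite [X in _ <= X]mulrA k6; lra.
have uz : b i u z = kap * q i y.
  by rewrite /u nf_scalel /v (iter_avg_adjoint N W'W).
have uu : b i u u <= 2 * kap ^+ 2 * q i y.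
  have h : b i v v <= 2 * q i y by apply: iter_avg_sqr_le => // k; apply: qW'.
  have := ler_wpM2l (sqr_ge0 kap) h; rewrite /u !nf_bilin; lra.
have qy : kap * q i y <= 1 + (`|K| + 1) * s.
  clearbody t; clearbody u; move: ht; rewrite !nf_bilin [b i t u]nf_sym => ht.
  have tt := mulr_ge0 (sqr_ge0 s) (nf_ge0 i t).
  have Ks : K * s ^+ 2 <= `|K| * s ^+ 2 by rewrite ler_wpM2r ?sqr_ge0 ?ler_norm.
  rewrite -(ler_pM2l s0).
  have := ler_wpM2l (ltW s0) A'u; have := congr1 ( *%R s) ut.
  rewrite uz; lra.
have := ler_wpM2l (ltW kap0) qy.
have ss : s ^+ 2 <= s by rewrite expr2 ler_piMr// ltW.
lra.
Qed.

End iterate_average.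

(** * Roots of unity *)

Lemma primitive_root_exists (F : numClosedFieldType) n :
  (0 < n)%N -> exists w : F, n.-primitive_root w.
Proof.
move=> n0; have [r Er] := closed_field_poly_normal ('X^n - 1 : {poly F}).
rewrite (monicP (monicXnsubC 1 n0)) scale1r in Er.
have ur : uniq r.
  by rewrite -separable_prod_XsubC -Er separable_Xn_sub_1// pnatr_eq0 -lt0n.
have sr : (n <= size r)%N.
  by rewrite -ltnS -(size_prod_XsubC r id) -Er size_XnsubC.
have rn : all n.-unity_root r by apply/allP => z; rewrite -root_prod_XsubC -Er.
by have /hasP[w _ wn] := has_prim_root n0 rn ur sr; exists w.
Qed.

Section roots_of_unity.
Context (F : numClosedFieldType) (n : nat) (w : F).
Hypothesis wP : n.-primitive_root w.

Lemma norm_prim_root : `|w| = 1.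
Proof.
have n0 := prim_order_gt0 wP.
apply/eqP; rewrite -(@pexpr_eq1 _ _ n)// -normrX (prim_expr_order wP) normr1//.
Qed.

(** The sum is geometric; its ratio [z] is an [n]-th root of unity and equals 1 only for [a = d]. *)
Lemma prim_root_orthogonal (a d : nat) : (a < n)%N -> (d < n)%N ->
  \sum_(j < n) ((w ^+ (j * a))^* * w ^+ (j * d)) = if a == d then n%:R else 0.
Proof.
move=> an dn; pose z := (w ^+ a)^* * w ^+ d.
have wa : `|w ^+ a| = 1 by rewrite normrX norm_prim_root expr1n.
have -> : \sum_(j < n) ((w ^+ (j * a))^* * w ^+ (j * d)) = \sum_(j < n) z ^+ j.
  by apply: eq_bigr => j _; rewrite /z !(mulnC j) !exprM exprMn rmorphXn.
have zn : z ^+ n = 1.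
  rewrite /z exprMn -rmorphXn -!exprM ![(_ * n)%N]mulnC !exprM (prim_expr_order wP).
  by rewrite !expr1n rmorph1 mulr1.
have [ad|ad] := eqVneq a d.
  have z1 : z = 1 by rewrite /z ad mulrC -normCK -ad wa expr1n.
  by rewrite z1 (eq_bigr (fun=> 1)) ?sumr_const ?card_ord// => j _; rewrite expr1n.
have z1 : z - 1 != 0.
  rewrite subr_eq0; apply: contra_neq ad => z1.
  have /eqP : w ^+ a = w ^+ d.
    by rewrite -[LHS]mulr1 -z1 /z mulrA -normCK wa expr1n mul1r.
  by rewrite (eq_prim_root_expr wP) !modn_small// => /eqP.
by apply: (mulfI z1); rewrite -subrX1 zn subrr mulr0.
Qed.

End roots_of_unity.

(* The average p_j of the powers of w^j U is concentrated on the part of the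
   spectrum of U at distance O(1/N) from w^-j; the sums over j are computed by
   Parseval over the 2N-th roots of unity. *)
Section fourier_localization.
Context (R : realType) (V : normedModType R[i]) (b : norming_forms V).
Context (U U' : {linear V -> V}) (N : nat) (w : R[i]).
Hypotheses (N0 : (0 < N)%N) (wP : (2 * N).-primitive_root w) (UU' : nf_adjoint b U U').
Implicit Types (i : nf_index b) (x y : V).

Let q i x : R := b i x x.
Let W j x : V := w ^+ j *: U x.
Let W' j x : V := (w ^+ j)^* *: U' x.

Let W_linear j : linear (W j).
Proof. by move=> a x y; rewrite /W linearP scalerDr !scalerA mulrC. Qed.
Let W'_linear j : linear (W' j).
Proof. by move=> a x y; rewrite /W' linearP scalerDr !scalerA mulrC. Qed.

HB.instance Definition _ j := GRing.isLinear.Build R[i] V V *:%R (W j) (W_linear j).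
HB.instance Definition _ j := GRing.isLinear.Build R[i] V V *:%R (W' j) (W'_linear j).

Let w1 j : `|w ^+ j| = 1.
Proof. by rewrite normrX (norm_prim_root wP) expr1n. Qed.

Let WW' j : nf_adjoint b (W j) (W' j).
Proof. by move=> i x y; rewrite /W /W' nf_conj UU' linearZ. Qed.

Let iterW j k x : iter k (W j) x = w ^+ (j * k) *: iter k U x.
Proof.
elim: k => [|k IH]; first by rewrite muln0 scale1r.
by rewrite !iterS IH /W linearZ scalerA -exprD mulnS.
Qed.

Let iterW' j k x : iter k (W' j) x = (w ^+ (j * k))^* *: iter k U' x.
Proof.
elim: k => [|k IH]; first by rewrite muln0 rmorph1 scale1r.
by rewrite !iterS IH /W' linearZ scalerA -rmorphM -exprD mulnS.
Qed.

(** Orthogonality of characters, collected in one argument by [nf_conj]. The order [2 * N] leaves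
    room for sums of two exponents below [N]. *)
Let sum_form i a d x y : (a < 2 * N)%N -> (d < 2 * N)%N ->
  \sum_(j < 2 * N) b i (w ^+ (j * a) *: x) (w ^+ (j * d) *: y) =
  if a == d then (2 * N)%:R * b i x y else 0.
Proof.
move=> aN dN.
have -> : \sum_(j < 2 * N) b i (w ^+ (j * a) *: x) (w ^+ (j * d) *: y) =
    b i x ((\sum_(j < 2 * N) (w ^+ (j * a))^* * w ^+ (j * d)) *: y).
  rewrite scaler_suml nf_sumr; apply: eq_bigr => j _.
  by rewrite nf_conj scalerA.
rewrite (prim_root_orthogonal wP aN dN); case: eqP => _; last by rewrite scale0r nf_0r.
by rewrite -nf_scaler rmorph_nat.
Qed.

Let p j := iter_avg (W j) N.
Let p' j := iter_avg (W' j) N.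

Hypothesis qU : forall i x k, (k <= N)%N -> q i (iter k U x) <= 2 * q i x.
Hypothesis qU' : forall i x k, (k <= N)%N -> q i (iter k U' x) <= 2 * q i x.
Hypothesis q_leU : forall i x, q i x <= q i (U x).

Let pE j x : p j x = \sum_(k < N) (w ^+ (j * k) *: ((N%:R^-1)%:C *: iter k U x)).
Proof.
rewrite /p /iter_avg scaler_sumr; apply: eq_bigr => k _.
by rewrite iterW !scalerA mulrC.
Qed.

Let n0 : 0 < N%:R :> R. Proof. by rewrite ltr0n. Qed.

Let ltN2 k : (k < N)%N -> (k < 2 * N)%N.
Proof. by move=> kN; rewrite mul2n -addnn ltn_addl. Qed.


Let pb j i x y : b i (p j x) y = \sum_(k < N) b i (w ^+ (j * k) *: ((N%:R^-1)%:C *: iter k U x)) y.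
Proof. by rewrite pE nf_suml. Qed.

(** Parseval: only [k = l] survives, giving [N] terms, each [2 / N] times a value at most
    [2 * q i x]. *)
Let sum_sqr_p i x : \sum_(j < 2 * N) q i (p j x) <= 4 * q i x.
Proof.
have -> : \sum_(j < 2 * N) q i (p j x) =
    \sum_(k < N) \sum_(l < N) \sum_(j < 2 * N)
      b i (w ^+ (j * k) *: ((N%:R^-1)%:C *: iter k U x))
          (w ^+ (j * l) *: ((N%:R^-1)%:C *: iter l U x)).
  under [LHS]eq_bigr => j _ do rewrite /q pb.
  rewrite exchange_big /=.
  apply: eq_bigr => k _; rewrite exchange_big /=; apply: eq_bigr => j _.
  by rewrite [in LHS]pE nf_sumr.
apply: (@le_trans _ _ (\sum_(k < N) 4 * N%:R^-1 * q i x)).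
  apply: ler_sum => k _; rewrite (bigD1 k)//= sum_form ?ltN2// eqxx big1 => [|l /negPf lk].
    rewrite addr0 nf_scalel nf_scaler natrM -/(q i _).
    have := qU i x (ltnW (ltn_ord k)).
    have -> : 2 * N%:R * (N%:R^-1 * (N%:R^-1 * q i (iter k U x))) = 2 * N%:R^-1 * q i (iter k U x).
      by field; rewrite gt_eqF.
    have : 0 < N%:R^-1 :> R by rewrite invr_gt0.
    nra.
  by rewrite sum_form ?ltN2// eq_sym; move: lk; rewrite -val_eqE => ->.
rewrite sumr_const card_ord -[X in X <= _]mulr_natl.
by rewrite le_eqVlt; apply/orP; left; apply/eqP; field; rewrite gt_eqF.
Qed.

Let q_le_iter i x k : q i x <= q i (iter k U x).
Proof. by elim: k => // k IH; apply: le_trans IH (q_leU _ _). Qed.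

Let iter_p j k x :
  iter k U (p j x) = \sum_(l < N) (w ^+ (j * l) *: ((N%:R^-1)%:C *: iter (k + l) U x)).
Proof.
elim: k => [|k IH]; first exact: pE.
rewrite iterS IH linear_sum; apply: eq_bigr => l _.
by rewrite [LHS]linearZ; congr (_ *: _); rewrite [LHS]linearZ.
Qed.

(** Move [p'] across the form and expand; the triples with [d = k + l] survive. There are [d + 1] of
    them for each [d < N], so [N (N + 1) / 2] in all, and each contributes at least [2 / N ^+ 2]
    times [q i x] because [U] does not decrease the forms. *)
Let sum_form_p i x : q i x <= \sum_(j < 2 * N) b i (p' j (p j x)) (p j x).
Proof.
have p'p j y z : b i (p' j y) z = b i y (p j z).
  by rewrite /p' (iter_avg_adjoint (W := W' j) (W' := W j) N) // => i' x' y'; rewrite nf_sym -WW' nf_sym.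
pose c : R[i] := (N%:R^-1)%:C.
have -> : \sum_(j < 2 * N) b i (p' j (p j x)) (p j x) =
    \sum_(d < N) \sum_(k < N) \sum_(l < N) \sum_(j < 2 * N)
      b i (w ^+ (j * d) *: (c *: iter d U x))
          (w ^+ (j * (k + l)) *: (c *: (c *: iter (k + l) U x))).
  under eq_bigr => j _ do rewrite p'p pb.
  rewrite exchange_big /=; apply: eq_bigr => d _.
  under eq_bigr => j _ do rewrite [p j (p j x)]pE nf_sumr.
  rewrite exchange_big /=; apply: eq_bigr => k _.
  rewrite exchange_big /=; apply: eq_bigr => j _.
  by rewrite -nf_sumr iter_p !scaler_sumr; congr (b i _ _); apply: eq_bigr => l _;
    rewrite !scalerA mulnDr exprD; congr (_ *: _); ring.
have h (d k l : 'I_N) : \sum_(j < 2 * N)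
      b i (w ^+ (j * d) *: (c *: iter d U x))
          (w ^+ (j * (k + l)) *: (c *: (c *: iter (k + l) U x))) =
   if d == (k + l)%N :> nat then 2 * N%:R ^- 2 * q i (iter d U x) else 0.
  have kl : (k + l < 2 * N)%N by rewrite mul2n -addnn -addnS leq_add// ltnW.
  rewrite (sum_form _ _ _ (ltN2 (ltn_ord d)) kl).
  case: eqP => // <-; rewrite /c nf_scalel !nf_scaler natrM -/(q i _).
  by field; rewrite gt_eqF.
under eq_bigr => d _ do under eq_bigr => k _ do under eq_bigr => l _ do rewrite h.
have c0 : 0 <= 2 * N%:R ^- 2 * q i x by rewrite !mulr_ge0 ?invr_ge0 ?exprn_ge0// nf_ge0.
have cd d : 2 * N%:R ^- 2 * q i x <= 2 * N%:R ^- 2 * q i (iter d U x).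
  by rewrite ler_wpM2l ?q_le_iter// mulr_ge0// invr_ge0 exprn_ge0.
apply: (@le_trans _ _ (\sum_(d < N) d.+1%:R * (2 * N%:R ^- 2 * q i x))); last first.
  apply: ler_sum => d _.
  apply: (@le_trans _ _ (\sum_(k < N) if (k < d.+1)%N then 2 * N%:R ^- 2 * q i x else 0)).
    rewrite -big_mkcond -(big_ord_widen _ (fun=> 2 * N%:R ^- 2 * q i x) (ltn_ord d)).
    by rewrite sumr_const card_ord mulr_natl.
  apply: ler_sum => k _; case: ifP => kd; last first.
    by apply: sumr_ge0 => l _; case: ifP => // _; exact: le_trans c0 (cd _).
  have dkN : (d - k < N)%N by apply: leq_ltn_trans (leq_subr _ _) (ltn_ord d).
  rewrite (bigD1 (Ordinal dkN))//= subnKC// eqxx -[leLHS]addr0 lerD//.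
  by apply: sumr_ge0 => l _; case: ifP => // _; exact: le_trans c0 (cd _).
rewrite -mulr_suml.
have sN : \sum_(d < N) d.+1%:R = (N%:R * N.+1%:R) / 2 :> R.
  elim: (N) => [|M IH]; first by rewrite big_ord0 !mul0r.
  by rewrite big_ord_recr /= IH -!natr1; field.
rewrite sN -[N.+1%:R]natr1.
have -> : N%:R * (N%:R + 1) / 2 * (2 * N%:R ^- 2 * q i x) = q i x + N%:R^-1 * q i x.
  by field; rewrite gt_eqF.
by rewrite lerDl mulr_ge0 ?invr_ge0 ?nf_ge0// ltW.
Qed.

Lemma sum_localized_ge i x :
  q i x <= 4 * \sum_(j < 2 * N) q i (p' j (p j x)).
Proof.
have h j : b i (p' j (p j x)) (p j x) <= 2 * q i (p' j (p j x)) + q i (p j x) / 8.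
  (* With weight 4 the last terms sum to at most [q i x / 2], which is absorbed on the left. *)
  have := nf_AMGM i (p' j (p j x)) (p j x) 4; rewrite -!/(q i _); lra.
have := le_trans (sum_form_p i x) (ler_sum _ (fun (j : 'I_(2 * N)) _ => h j)).
rewrite big_split /= -mulr_sumr -mulr_suml; have := sum_sqr_p i x; lra.
Qed.

(** Choosing [l = w ^- j] makes [w ^+ j *: z] a limit for [W j - 1], with the same [z] for all [j];
    phases do not change the forms. The averaging bound then gives [2 N] terms of size
    [12 / N ^+ 2]. *)
Lemma ball_limit_localized z : (forall l, ball_limit (fun x => U x - l *: x) z) ->
  rnorm z ^+ 2 <= 96 / N%:R.
Proof.
move=> lz; apply: (rnorm_sqr_le (b := b)) => i.
apply: le_trans (sum_localized_ge i z) _.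
have h (j : nat) : q i (p' j (p j z)) <= 12 / N%:R ^+ 2.
  pose y := w ^+ j *: z.
  have -> : q i (p' j (p j z)) = q i (p' j (p j y)).
    have -> : p j y = w ^+ j *: p j z by exact: iter_avgZ.
    have -> : p' j (w ^+ j *: p j z) = w ^+ j *: p' j (p j z) by exact: iter_avgZ.
    by rewrite /q nf_unit.
  apply: le_trans (nf_le i _) _; apply: ball_limit_iter_avg => //.
  - exact: WW'.
  - move=> i' x k kN; rewrite iterW nf_unit//; exact: qU.
  - move=> i' x k kN; rewrite iterW' nf_unit ?norm_conjC//; exact: qU'.
  have wj0 : w ^+ j != 0 by rewrite -normr_eq0 w1 oner_eq0.
  have := ball_limitZ wj0 (lz (w ^+ j)^-1).
  suff -> : (fun x => w ^+ j *: (U x - (w ^+ j)^-1 *: x)) = (fun x => W j x - x) by [].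
  by apply/funext => x; rewrite scalerBr scalerA mulfV// scale1r.
apply: (@le_trans _ _ (4 * \sum_(j < 2 * N) 12 / N%:R ^+ 2)).
  by rewrite ler_pM2l// ler_sum.
rewrite sumr_const card_ord -[(12 / _) *+ _]mulr_natl natrM.
by rewrite le_eqVlt; apply/orP; left; apply/eqP; field; rewrite gt_eqF.
Qed.

End fourier_localization.

(** * Self-adjoint contractions and weak* limits *)

Section selfadjoint_limit.
Context (R : realType) (V : normedModType R[i]) (b : norming_forms V).
Context (T : {linear V -> V}).
Hypotheses (TT : nf_adjoint b T T) (qT : forall i x, b i (T x) (T x) <= b i x x).
Implicit Types (i : nf_index b) (x y : V) (s : R).

Let q i x : R := b i x x.

(* The second order Taylor polynomial of exp(i s T): unitary up to O(s^4). *)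
Definition expi2 s x : V := x + ('i * s%:C) *: T x - (s ^+ 2 / 2)%:C *: T (T x).

Lemma expi2_linear s : linear (expi2 s).
Proof.
move=> a x y; rewrite /expi2 !linearP /= !scalerDr -!addrA; congr (_ + _).
by rewrite addrCA; congr (_ + _); rewrite [RHS]addrCA; congr (_ + _); rewrite addrCA.
Qed.

HB.instance Definition _ s := GRing.isLinear.Build R[i] V V *:%R (expi2 s) (expi2_linear s).

Lemma expi2_adjoint s : nf_adjoint b (expi2 s) (expi2 (- s)).
Proof.
move=> i x y; rewrite /expi2 !nf_addl !nf_addr !nf_oppl !nf_oppr !nf_scalel !nf_scaler !TT sqrrN.
congr (_ + _ - _).
have sR : s%:C \is Num.real by rewrite complex_real.
by rewrite nf_conj rmorphM /= conjCi (conj_Creal sR) rmorphN mulrN mulNr TT linearZ.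
Qed.

Lemma form_iT i x : b i x ('i *: T x) = 0.
Proof.
have : b i x ('i *: T x) = - b i x ('i *: T x).
  by rewrite [LHS]nf_sym nf_i TT linearZ.
lra.
Qed.

(** The terms of even and odd order in [s] are orthogonal as [T] is self-adjoint, and the
    contributions of order [s ^+ 2] cancel. *)
Lemma expi2_sqr s i x : q i (expi2 s x) = q i x + s ^+ 4 / 4 * q i (T (T x)).
Proof.
have E : expi2 s x = (x - (s ^+ 2 / 2)%:C *: T (T x)) + s%:C *: ('i *: T x).
  by rewrite /expi2 scalerA [s%:C * _]mulrC addrAC.
have h1 : b i x ('i *: T x) = 0 by exact: form_iT.
have h2 : b i (T (T x)) ('i *: T x) = 0.
  by rewrite TT linearZ form_iT.
have h3 : b i ('i *: T x) ('i *: T x) = q i (T x) by rewrite nf_unit// normCi.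
have h4 : b i x (T (T x)) = q i (T x) by rewrite -TT.
rewrite /q E !nf_addl !nf_addr !nf_oppl !nf_oppr !nf_scalel !nf_scaler.
rewrite ![b i ('i *: T x) _]nf_sym [b i (T (T x)) x]nf_sym h1 h2 h3 h4 /q.
by field.
Qed.

Lemma expi2_sqr_ge s i x : q i x <= q i (expi2 s x).
Proof. by rewrite expi2_sqr lerDl mulr_ge0 ?divr_ge0 ?nf_ge0// exprn_even_ge0. Qed.

Lemma expi2_iter_sqr_le s N i x k : (k <= N)%N -> s ^+ 4 * N%:R <= 1 ->
  q i (iter k (expi2 s) x) <= 2 * q i x.
Proof.
move=> kN sN; have q0 := nf_ge0 i x.
have s4 : 0 <= s ^+ 4 by rewrite exprn_even_ge0.
(* One step costs a factor [1 + s ^+ 4 / 4]; the rate 1/2 instead of 1/4 absorbs the product term,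
   as [k s^4 <= 1]. *)
suff : q i (iter k (expi2 s) x) <= (1 + k%:R * s ^+ 4 / 2) * q i x.
  have ks : k%:R * s ^+ 4 <= 1.
    by apply: le_trans sN; rewrite mulrC ler_wpM2l// ler_nat.
  by move=> /le_trans; apply; rewrite ler_wpM2r//; lra.
elim: k kN => [|k IH] kN; first by rewrite !mul0r addr0 mul1r.
have {}IH := IH (ltnW kN); rewrite iterS expi2_sqr; set y := iter _ _ _ in IH *.
have TTy : q i (T (T y)) <= q i y by apply: le_trans (qT _ _) (qT _ _).
have kN1 : k%:R <= N%:R - 1 :> R by rewrite lerBrDr natr1 ler_nat.
have k0 : 0 <= k%:R :> R by [].
have h1 : q i y + s ^+ 4 / 4 * q i (T (T y)) <= (1 + s ^+ 4 / 4) * q i y.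
  by rewrite mulrDl mul1r lerD2l ler_wpM2l// divr_ge0.
apply: le_trans h1 _.
have h2 : (1 + s ^+ 4 / 4) * q i y <= (1 + s ^+ 4 / 4) * ((1 + k%:R * s ^+ 4 / 2) * q i x).
  by rewrite ler_wpM2l// addr_ge0// divr_ge0.
apply: le_trans h2 _; rewrite mulrA ler_wpM2r// -[k.+1%:R]natr1.
have ks : k%:R * s ^+ 4 <= 1.
  by apply: le_trans sN; rewrite mulrC ler_wpM2l// ler_nat ltnW.
have := ler_wpM2l s4 ks; lra.
Qed.

(** Here [z1] and [z2] stand for the limits of [T x] and [T (T x)], while [x] has limit 0, so [a]
    drops out. For [s = 1 / n] and [N = n ^ 4] the limit [y] of [expi2 s x] has norm [O(s^2)], but
    its first order term is [i s z1]. *)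
Lemma selfadjoint_limit0 (z1 z2 : V) :
  (forall a c d : R[i], ball_limit (fun x => a *: x + c *: T x + d *: T (T x))
     (c *: z1 + d *: z2)) -> z1 = 0.
Proof.
(* 10 exceeds the square root of 96; the other summand comes from the second order term of
   [expi2]. *)
move=> lz; pose C := 10 + rnorm z2 / 2.
have C0 : 0 <= C by rewrite addr_ge0// divr_ge0// rnorm_ge0.
suff key n : (0 < n)%N -> n%:R * rnorm z1 <= C.
  apply: rnorm0_eq0; rewrite leNgt; apply/negP => z1_gt0.
  have := archi_boundP (divr_ge0 C0 (ltW z1_gt0)); set n := Num.bound _ => hn.
  have n0 : (0 < n)%N.
    by rewrite -(ltr_nat R); apply: le_lt_trans hn; rewrite divr_ge0// ltW.
  by move: hn; rewrite ltr_pdivrMr// ltNge key.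
move=> n0; have n0R : 0 < n%:R :> R by rewrite ltr0n.
pose N := (n ^ 4)%N; pose s : R := n%:R^-1.
have N0 : (0 < N)%N by rewrite expn_gt0 n0.
have s0 : 0 < s by rewrite invr_gt0.
have s4N : s ^+ 4 * N%:R = 1.
  by rewrite /N natrX -exprMn /s mulVf ?expr1n// gt_eqF.
have N20 : (0 < 2 * N)%N by rewrite muln_gt0.
have [w wP] := primitive_root_exists R[i] N20.
pose y := ('i * s%:C) *: z1 + (- (s ^+ 2 / 2)%:C) *: z2.
have y96 : rnorm y ^+ 2 <= 96 / N%:R.
  apply: (ball_limit_localized (b := b) N0 wP (expi2_adjoint s)) => [i x k kN|i x k kN|i x|l].
  - by apply: (expi2_iter_sqr_le _ _ kN); rewrite s4N.
  - by apply: (expi2_iter_sqr_le _ _ kN); rewrite (_ : (- s) ^+ 4 = s ^+ 4) ?s4N//; ring.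
  - exact: expi2_sqr_ge.
  - have := lz (1 - l) ('i * s%:C) (- (s ^+ 2 / 2)%:C).
    congr (ball_limit _ _); apply/funext => x.
    by rewrite /expi2 scalerBl scale1r scaleNr -!addrA; congr (_ + _); rewrite addrC addrA.
have ys : rnorm y <= 10 * s ^+ 2.
  have s2 : 0 <= 10 * s ^+ 2 by rewrite mulr_ge0// sqr_ge0.
  rewrite -(@ler_pXn2r _ 2)// ?nnegrE ?rnorm_ge0//; apply: le_trans y96 _.
  have -> : N%:R^-1 = s ^+ 4 by rewrite /N natrX exprVn.
  have s4 : 0 <= s ^+ 4 by rewrite exprn_even_ge0.
  rewrite exprMn -exprM; lra.
have z1y : s * rnorm z1 <= rnorm y + s ^+ 2 / 2 * rnorm z2.
  have -> : s * rnorm z1 = rnorm (('i * s%:C) *: z1).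
    by rewrite -scalerA rnormZ (rnorm_unit (normCi _)) mul1r rnormZr gtr0_norm.
  have -> : s ^+ 2 / 2 * rnorm z2 = rnorm (- (- (s ^+ 2 / 2)%:C *: z2)).
    by rewrite scaleNr opprK rnormZr ger0_norm// divr_ge0// sqr_ge0.
  by apply: le_trans (rnormD _ _); rewrite addrK.
have : s * rnorm z1 <= s * (s * C).
  have -> : s * (s * C) = 10 * s ^+ 2 + s ^+ 2 / 2 * rnorm z2 by rewrite /C; ring.
  by apply: le_trans z1y _; rewrite lerD2r.
rewrite ler_pM2l// => h.
by have := ler_wpM2l (ltW n0R) h; rewrite mulrA /s mulfV ?mul1r// gt_eqF.
Qed.

End selfadjoint_limit.

(** * Pre-adjoints of adjointable operators *)

Section predual_theory.
Context (R : realType) (V : normedModType R[i]) (P : completeNormedModType R[i]).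
Context (phi : isometric_iso V (dual P)).
Implicit Types (x y z u : V) (p : P) (f mu : dual V).

Lemma rnorm_iso x : rnorm (phi x) = rnorm x.
Proof. by rewrite /rnorm iso_norm. Qed.

Lemma iso_inj x y : phi x = phi y -> x = y.
Proof.
move=> xy; apply/eqP; rewrite -subr_eq0; apply/eqP/rnorm0_eq0.
by rewrite -rnorm_iso linearB xy subrr rnorm0.
Qed.

Lemma rnorm_pairing x p : rnorm (phi x p) <= rnorm x * rnorm p.
Proof. by rewrite -rnorm_iso; exact: rnorm_bop. Qed.

(** As [phi] is onto, a norming functional of [p] is [phi x] for some [x] in the unit ball. *)
Lemma rnorm_predual_emb p : rnorm (predual_emb phi p) = rnorm p.
Proof.
apply/eqP; rewrite eq_le; apply/andP; split.
  apply: rnorm_bop_le => [|x x1]; first exact: rnorm_ge0.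
  by apply: le_trans (rnorm_pairing x p) _; rewrite ler_piMl// rnorm_ge0.
have [g g1 gp] := norming_functional p; have [x xg] := iso_surj phi g.
have x1 : rnorm x <= 1.
  by rewrite -rnorm_iso xg; apply: rnorm_bop_le => // q q1; apply: le_trans (g1 q) q1.
rewrite -xg in gp; apply: le_trans gp _.
by apply: le_trans (rnorm_bop (predual_emb phi p) x) _; rewrite ler_piMr// rnorm_ge0.
Qed.

Lemma predual_emb_is_linear : linear (predual_emb phi).
Proof. by move=> a p q; apply: bop_ext => x; rewrite /= linearP. Qed.
HB.instance Definition _ :=
  GRing.isLinear.Build R[i] P (dual V) *:%R (predual_emb phi) predual_emb_is_linear.

Lemma predual_emb_inj p q : (forall x, phi x p = phi x q) -> p = q.
Proof.
move=> pq; apply/eqP; rewrite -subr_eq0; apply/eqP/rnorm0_eq0.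
rewrite -rnorm_predual_emb; apply: rnorm_bop_le => // x _.
have -> : predual_emb phi (p - q) x = phi x p - phi x q by exact: linearB.
by rewrite pq subrr rnorm0.
Qed.

Lemma range_predual_submod : submod_closed (mem (range (predual_emb phi))).
Proof.
split; first by rewrite inE; exists 0 => //; rewrite linear0.
move=> a f g; rewrite !inE => -[p _ <-] [q _ <-].
by exists (a *: p + q) => //; rewrite linearP.
Qed.

(** The embedding is isometric, so good approximants form a Cauchy sequence in the complete space
    [P]. *)
Lemma range_predual_closed f :
  (forall e : R, 0 < e -> exists p, rnorm (f - predual_emb phi p) < e) ->
  range (predual_emb phi) f.
Proof.
move=> hf.
have /choice[v vP] : forall n : nat, exists p, rnorm (f - predual_emb phi p) < n.+1%:R^-1.
  by move=> n; apply: hf; rewrite invr_gt0.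
have vv m n : rnorm (v m - v n) <= m.+1%:R^-1 + n.+1%:R^-1.
  rewrite -rnorm_predual_emb linearB.
  have -> : predual_emb phi (v m) - predual_emb phi (v n) =
      (f - predual_emb phi (v n)) - (f - predual_emb phi (v m)).
    by rewrite opprB [RHS]addrC addrA subrK.
  apply: le_trans (rnormD _ _) _; rewrite rnormN addrC lerD// ltW//.
have small (e : R) : 0 < e -> \forall n \near \oo, n.+1%:R^-1 < e.
  by move=> e0; exact: (near_infty_natSinv_lt (PosNum e0)).
have eRe (e : R[i]) : 0 < e -> e = (complex.Re e)%:C /\ 0 < complex.Re e.
  move=> e0; have h : (complex.Re e)%:C = e by rewrite RRe_real// gtr0_real.
  by split=> //; rewrite -ltcR h.
have cv : cvg (v @ \oo).
  apply: cauchy_cvg; apply: cauchy_exP => _/posnumP[e].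
  have [eE e0] := eRe e%:num [gt0 of e%:num].
  have [N _ hN] := small _ (divr_gt0 e0 (ltr0n _ 2)).
  exists (v N); exists N => // n /= Nn.
  rewrite -ball_normE /= -rnormE eE ltcR; apply: le_lt_trans (vv _ _) _.
  by rewrite [ltRHS]splitr ltrD//; apply: hN => //=.
exists (lim (v @ \oo)) => //; apply/esym/eqP; rewrite -subr_eq0; apply/eqP/rnorm0_eq0.
apply: (le_of_small_slope (C := 2)) => e e0 _; rewrite add0r.
have e0' : 0 < e%:C :> R[i] by rewrite ltcR.
near \oo => n.
have -> : f - predual_emb phi (lim (v @ \oo)) =
    (f - predual_emb phi (v n)) - predual_emb phi (lim (v @ \oo) - v n).
  by rewrite linearB opprB addrA subrK.
apply: le_trans (rnormD _ _) _; rewrite rnormN rnorm_predual_emb.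
rewrite mulr_natl mulr2n lerD//.
  apply: ltW; apply: lt_trans (vP n) _; near: n; exact: small.
rewrite rnorm_lec; near: n; by move: cv => /cvgrPdist_le; apply.
Unshelve. all: by end_near. Qed.

Lemma range_predual_separation f : ~ range (predual_emb phi) f ->
  exists G : dual (dual V), [/\ forall mu, rnorm (G mu) <= rnorm mu,
    forall p, G (predual_emb phi p) = 0 & G f != 0].
Proof.
move=> fP.
have [e e0 he] : exists2 e : R, 0 < e & forall p, e <= rnorm (f - predual_emb phi p).
  apply: contra_notP fP => h; apply: range_predual_closed => e e0.
  apply: contra_notP h => h; exists e => // p; rewrite leNgt; apply/negP => pe.
  by apply: h; exists p.
have [_ [p _ <-]|G [G1 G0 Gf]] := @Hahn_Banach_dist _ _ (LinSub range_predual_submod) f e.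
  exact: he.
exists G; split=> // [p|]; first by apply: G0; exists p.
by apply/eqP => Gf0; move: Gf; rewrite Gf0 leNgt e0.
Qed.

(* [G] plays the role of a net in the unit ball of V that converges weak* to 0;
   the z below are then the weak* limits of its images under A. *)
Section bidual_limit.
Context (G : dual (dual V)).
Hypothesis G1 : forall mu, rnorm (G mu) <= rnorm mu.

Lemma bidual_limit_exists (A : bop V V) :
  exists z, forall p, phi z p = G (predual_emb phi p \oB A).
Proof.
have lf : linear (fun p => G (predual_emb phi p \oB A)).
  by move=> a p q; rewrite linearP bop_comp_linl linearP.
have bf p : `|G (predual_emb phi p \oB A)| <= `|A| * `|p|.
  apply: le_trans (_ : `|predual_emb phi p \oB A| <= _); first by rewrite -rnorm_le.
  apply: le_trans (bop_comp_norm _ _) _; rewrite mulrC ler_wpM2l//.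
  by rewrite -rnorm_le rnorm_predual_emb.
by have [z zE] := iso_surj phi (mk_bop lf bf); exists z => p; rewrite zE.
Qed.

Lemma bidual_ball_limit (A : bop V V) z :
  (forall p, phi z p = G (predual_emb phi p \oB A)) -> ball_limit A z.
Proof.
move=> zE u M h.
have uM : rnorm u <= M by have := h 0; rewrite linear0 add0r rnorm0; apply.
have M0 : 0 <= M by apply: le_trans uM; exact: rnorm_ge0.
rewrite -rnorm_iso; apply: rnorm_bop_le => // p p1.
have up : rnorm (phi u p) <= M.
  apply: le_trans (rnorm_pairing u p) _; apply: le_trans uM.
  by rewrite ler_piMr// rnorm_ge0.
have -> : phi (z + u) p = phi z p + phi u p by rewrite linearD.
apply: le_trans (rnormD _ _) _; rewrite zE -lerBrDr.
apply: le_trans (G1 _) _; apply: rnorm_bop_le => [|x x1]; first by rewrite subr_ge0.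
rewrite lerBrDr /=.
(* The unit ball is invariant under phases: replacing [x] by [t *: x] aligns the two values, and the
   sum of their moduli becomes the modulus of one value [phi (A (t *: x) + u) p]. *)
have [a a1 aE] := phase (phi (A x) p); have [c c1 cE] := phase (phi u p).
pose t := c^* * a.
have t1 : rnorm (t *: x) <= 1.
  by rewrite rnormZ (rnorm_unit (_ : `|t| = 1)) ?mul1r// normrM norm_conjC a1 c1 mulr1.
have E : c * phi (A (t *: x) + u) p = (rnorm (phi (A x) p) + rnorm (phi u p))%:C.
  have -> : phi (A (t *: x) + u) p = t * phi (A x) p + phi u p.
    by rewrite linearZ linearP.
  rewrite rmorphD /= !rnormE.
  by rewrite mulrDr cE mulrA /t mulrA -normCK c1 expr1n mul1r aE.
have : rnorm (c * phi (A (t *: x) + u) p : R[i]^o) <= M.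
  rewrite -[X in rnorm X]/(c *: (phi (A (t *: x) + u) p : R[i]^o)) rnormZ (rnorm_unit c1) mul1r.
  apply: le_trans (rnorm_pairing _ _) _; apply: le_trans (h _ t1).
  by rewrite ler_piMr// rnorm_ge0.
by rewrite E rnorm_real ger0_norm// addr_ge0// rnorm_ge0.
Qed.

End bidual_limit.

Context (b : norming_forms V).

(** Otherwise some [G] vanishes on the predual but not on [predual_emb phi p0 \oB T]. Its first
    property says that the identity has limit 0, so the limit [z1] of [T] is 0, and this contradicts
    the second. *)
Lemma selfadjoint_preadjoint (T : bop V V) : nf_adjoint b T T ->
  (forall i x, b i (T x) (T x) <= b i x x) ->
  forall p, range (predual_emb phi) (predual_emb phi p \oB T).
Proof.
move=> TT qT p0; apply: contrapT => /range_predual_separation[G [G1 G0 /eqP]]; apply.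
have [z1 z1E] := bidual_limit_exists G1 T.
have [z2 z2E] := bidual_limit_exists G1 (T \oB T).
suff z10 : z1 = 0 by rewrite -z1E z10 linear0.
apply: (selfadjoint_limit0 TT qT (z2 := z2)) => a c d.
have idB x : `|idfun x| <= 1 * `|x| by rewrite mul1r.
pose I : bop V V := mk_bop (f := idfun) (fun _ _ _ => erefl) idB.
have := @bidual_ball_limit _ G1 (a *: I + (c *: T + d *: (T \oB T))) (c *: z1 + d *: z2).
rewrite (_ : bop_fun _ = fun x => a *: x + c *: T x + d *: T (T x)); last first.
  by apply/funext => x; rewrite -addrA.
apply => p.
have -> : predual_emb phi p \oB (a *: I + (c *: T + d *: (T \oB T))) =
    a *: predual_emb phi p + (c *: (predual_emb phi p \oB T) +
      d *: (predual_emb phi p \oB (T \oB T))).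
  apply: bop_ext => x.
  have := linearP (predual_emb phi p) c (T x) (d *: T (T x)).
  have := linearP (predual_emb phi p) a x (c *: T x + d *: T (T x)).
  rewrite /= => -> ->; congr (_ + (_ + _)).
  by rewrite linearZ.
have GP k mu nu : G (k *: mu + nu) = k *: G mu + G nu by exact: linearP.
have -> : phi (c *: z1 + d *: z2) p = c *: phi z1 p + d *: phi z2 p.
  by rewrite linearP linearZ.
rewrite !GP G0 scaler0 add0r z1E z2E; congr (_ + _).
by rewrite [RHS]linearZ.
Qed.

(** Write [T = (S1 - i S2) / (2 e)] with [S1], [S2] self-adjoint; [e] is small enough to make both
    contractive for the forms. *)
Lemma adjointable_preadjoint (T T' : bop V V) (C : R) : 0 <= C ->
  nf_adjoint b T T' -> (forall i x, b i (T x) (T x) <= C * b i x x) ->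
  (forall i x, b i (T' x) (T' x) <= C * b i x x) ->
  forall p, range (predual_emb phi) (predual_emb phi p \oB T).
Proof.
move=> C0 TT' qT qT' p.
have T'T i x y : b i (T' x) y = b i x (T y) by rewrite nf_sym -TT' nf_sym.
pose e : R := (1 + 4 * C)^-1.
have e0 : 0 < e by rewrite invr_gt0 ltr_wpDr// mulr_ge0.
have eC : e ^+ 2 * (4 * C) <= 1.
  have e1 : e * (1 + 4 * C) = 1 by rewrite /e mulVf// gt_eqF// -invr_gt0.
  nra.
have sqrT i x : b i (T x - T' x) (T x - T' x) <= 4 * C * b i x x.
  have := nf_sqrD i (T x) (T' x); have := qT i x; have := qT' i x; lra.
have sqrT' i x : b i (T x + T' x) (T x + T' x) <= 4 * C * b i x x.
  have := nf_sqrD i (T x) (- T' x); rewrite opprK nf_oppl nf_oppr opprK.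
  have := qT i x; have := qT' i x; lra.
pose S1 : bop V V := e%:C *: (T + T').
pose S2 : bop V V := ('i * e%:C) *: (T - T').
have bound i x y z : b i y y = e ^+ 2 * b i z z -> b i z z <= 4 * C * b i x x ->
    b i y y <= b i x x.
  move=> -> h; have := ler_wpM2l (sqr_ge0 e) h; have := nf_ge0 i x; nra.
have [q1 _ q1E] : range (predual_emb phi) (predual_emb phi p \oB S1).
  apply: selfadjoint_preadjoint => [i x y|i x].
    have -> : S1 x = e%:C *: (T x + T' x) by [].
    have -> : S1 y = e%:C *: (T y + T' y) by [].
    by rewrite nf_scalel nf_scaler nf_addl nf_addr TT' T'T addrC.
  apply: bound (sqrT' i x); have -> : S1 x = e%:C *: (T x + T' x) by [].
  by rewrite nf_scalel nf_scaler mulrA.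
have [q2 _ q2E] : range (predual_emb phi) (predual_emb phi p \oB S2).
  have S2E x : S2 x = 'i *: (e%:C *: (T x - T' x)) by rewrite scalerA.
  apply: selfadjoint_preadjoint => [i x y|i x].
    have -> : S2 y = e%:C *: ('i *: T y - 'i *: T' y).
      by rewrite -scalerBr scalerA mulrC -scalerA.
    rewrite S2E nf_i nf_scalel nf_scaler nf_addl nf_oppl nf_addr nf_oppr TT' T'T.
    have -> : T ('i *: y) = 'i *: T y by rewrite linearZ.
    have -> : T' ('i *: y) = 'i *: T' y by rewrite linearZ.
    ring.
  apply: bound (sqrT i x).
  by rewrite S2E nf_unit ?normCi// nf_scalel nf_scaler mulrA.
exists ((2 * e)^-1%:C *: (q1 - 'i *: q2)) => //.
have -> : predual_emb phi ((2 * e)^-1%:C *: (q1 - 'i *: q2)) =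
    (2 * e)^-1%:C *: (predual_emb phi q1 - 'i *: predual_emb phi q2).
  by rewrite linearZ linearB linearZ.
rewrite q1E q2E; apply: bop_ext => x.
have E1 : phi (S1 x) p = e%:C * (phi (T x) p + phi (T' x) p).
  by rewrite [S1 x](_ : _ = e%:C *: (T x + T' x))// linearZ linearD.
have E2 : phi (S2 x) p = 'i * e%:C * (phi (T x) p - phi (T' x) p).
  by rewrite [S2 x](_ : _ = ('i * e%:C) *: (T x - T' x))// linearZ linearB.
have -> : ((2 * e)^-1%:C *: ((predual_emb phi p \oB S1) - 'i *: (predual_emb phi p \oB S2))) x
  = (2 * e)^-1%:C * (phi (S1 x) p - 'i * phi (S2 x) p) by [].
rewrite E1 E2 !mulrA -expr2 sqr_i fmorphV rmorphM rmorph_nat /=.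
have eC0 : e%:C != 0 :> R[i].
  by rewrite -(rmorph0 (real_complex R)) (inj_eq (@complexI R)) gt_eqF.
by field.
Qed.

End predual_theory.

(** * Bimodule actions on a TRO *)

Section adjoint_theory.
Context (R : realType).
Implicit Types E F : hilbertType R.

Lemma adjoint_linear_comb E F (a : R[i]) (x y : bop E F) :
  adjoint (a *: x + y) = a^* *: adjoint x + adjoint y.
Proof.
apply/esym/adjoint_unique => u v.
rewrite [LHS](_ : _ = inner (a *: x u + y u) v)//.
rewrite [RHS](_ : _ = inner u (a^* *: adjoint x v + adjoint y v))//.
by rewrite innerDl innerZl innerDr innerZr conjCK !adjointP.
Qed.

Lemma adjointD E F (x y : bop E F) : adjoint (x + y) = adjoint x + adjoint y.
Proof. by rewrite -[x]scale1r adjoint_linear_comb rmorph1 !scale1r. Qed.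

Lemma adjoint0 E F : adjoint (0 : bop E F) = 0.
Proof.
by have := adjointD (0 : bop E F) 0; rewrite addr0 => /eqP; rewrite -subr_eq0 opprD addNKr oppr_eq0 => /eqP.
Qed.

Lemma adjointZ E F a (x : bop E F) : adjoint (a *: x) = a^* *: adjoint x.
Proof. by rewrite -[a *: x]addr0 adjoint_linear_comb adjoint0 addr0. Qed.

Lemma adjointB E F (x y : bop E F) : adjoint (x - y) = adjoint x - adjoint y.
Proof. by rewrite addrC -scaleN1r adjoint_linear_comb rmorphN1 scaleN1r addrC. Qed.

Lemma Re_inner_self E (u : E) : complex.Re (inner u u) = rnorm u ^+ 2.
Proof. by rewrite -sqr_norm_inner -rnormE -rmorphXn. Qed.

Lemma norm_adjoint_le E F (x : bop E F) : rnorm (adjoint x) <= rnorm x.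
Proof.
apply: rnorm_bop_le => [|v v1]; first exact: rnorm_ge0.
have := rnorm_ge0 (adjoint x v); rewrite le_eqVlt => /predU1P[<-|x0]; first exact: rnorm_ge0.
rewrite -(ler_pM2r x0) -expr2 -Re_inner_self -adjointP.
apply: le_trans (Re_le_rnorm _) _.
have := Cauchy_Schwarz (x (adjoint x v)) v.
rewrite -!rnormE -rmorphM lecR => /le_trans; apply.
apply: le_trans (_ : rnorm (x (adjoint x v)) <= _); last exact: rnorm_bop.
by rewrite ler_piMr// rnorm_ge0.
Qed.

Lemma norm_adjoint E F (x : bop E F) : rnorm (adjoint x) = rnorm x.
Proof.
apply/eqP; rewrite eq_le norm_adjoint_le /=.
by rewrite -{1}[x]adjointK norm_adjoint_le.
Qed.

Lemma bop_norm_approx (E F : normedModType R[i]) (f : bop E F) (e : R) : 0 < e ->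
  exists2 u, rnorm u <= 1 & rnorm f ^+ 2 - e <= rnorm (f u) ^+ 2.
Proof.
move=> e0; apply: contrapT => h; set M := rnorm f ^+ 2 - e in h.
have {}h u : rnorm u <= 1 -> rnorm (f u) ^+ 2 <= M.
  by move=> u1; rewrite leNgt; apply/negP => /ltW ?; apply: h; exists u.
have M0 : 0 <= M.
  by apply: le_trans (h 0 _); rewrite ?sqr_ge0// rnorm0.
have : rnorm f <= Num.sqrt M.
  apply: rnorm_bop_le => [|u u1]; first exact: sqrtr_ge0.
  rewrite -(@ler_pXn2r _ 2) ?nnegrE ?rnorm_ge0 ?sqrtr_ge0// sqr_sqrtr//; exact: h.
rewrite -(@ler_pXn2r _ 2) ?nnegrE ?rnorm_ge0 ?sqrtr_ge0// sqr_sqrtr// /M.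
by rewrite lerBrDl gerDr leNgt e0.
Qed.

Lemma Re_conj (z : R[i]) : complex.Re (z^*) = complex.Re z.
Proof. by case: z. Qed.

Lemma Re_innerC E (u v : E) : complex.Re (inner u v) = complex.Re (inner v u).
Proof. by rewrite innerC Re_conj. Qed.

Lemma Re_realM (r : R) (z : R[i]) : complex.Re (r%:C * z) = r * complex.Re z.
Proof. by case: z => a b /=; rewrite mul0r subr0. Qed.

End adjoint_theory.

Section tro_forms.
Context (R : realType) (K H : hilbertType R) (V : tro K H).

Let val (x : V) : bop K H := linsub_val x.

Definition left_form (i : {u : K | rnorm u <= 1}) (x y : V) : R :=
  complex.Re (inner (val x (sval i)) (val y (sval i))).

(** Right multiplications are adjointable here, since the adjoint of [x d] sends [v] to
    [d^* x^* v]. *)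
Definition right_form (i : {v : H | rnorm v <= 1}) (x y : V) : R :=
  complex.Re (inner (adjoint (val x) (sval i)) (adjoint (val y) (sval i))).

Definition left_forms : norming_forms V.
Proof.
apply: (@NormingForms R V _ left_form); rewrite /left_form.
- by move=> i x y; exact: Re_innerC.
- by move=> i x y z; rewrite -raddfD -innerDl.
- by move=> i r x y; rewrite -Re_realM -innerZl.
- move=> i a x y; have E c z : val (c *: z) (sval i) = c *: val z (sval i) by [].
  by rewrite !E innerZl innerZr conjCK.
- by move=> i x; rewrite Re_inner_self sqr_ge0.
- move=> i x; rewrite Re_inner_self ler_pXn2r ?nnegrE ?rnorm_ge0//.
  apply: le_trans (rnorm_bop _ _) _.
  by rewrite ler_piMr ?rnorm_ge0//; exact: svalP i.
- move=> x e /(bop_norm_approx (val x))[u u1 h].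
  by exists (exist _ u u1); rewrite Re_inner_self.
Defined.

Let valZ a x v : adjoint (val (a *: x)) v = a^* *: adjoint (val x) v.
Proof. by rewrite [val _](_ : _ = a *: val x)// adjointZ. Qed.

Definition right_forms : norming_forms V.
Proof.
apply: (@NormingForms R V _ right_form); rewrite /right_form.
- by move=> i x y; exact: Re_innerC.
- move=> i x y z; rewrite -raddfD -innerDl.
  by rewrite [val (x + y)](_ : _ = val x + val y)// adjointD.
- move=> i r x y; have rR : r%:C \is Num.real by rewrite complex_real.
  by rewrite valZ (conj_Creal rR) innerZl Re_realM.
- by move=> i a x y; rewrite !valZ innerZl innerZr conjCK.
- by move=> i x; rewrite Re_inner_self sqr_ge0.
- move=> i x; rewrite Re_inner_self ler_pXn2r ?nnegrE ?rnorm_ge0//.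
  apply: le_trans (rnorm_bop _ _) _; rewrite norm_adjoint.
  by rewrite ler_piMr ?rnorm_ge0//; exact: svalP i.
- move=> x e /(bop_norm_approx (adjoint (val x)))[u u1 h].
  by exists (exist _ u u1); rewrite Re_inner_self; move: h; rewrite norm_adjoint.
Defined.

End tro_forms.

Section adjoint_closed_span.
Context (R : realType) (E F : hilbertType R).

Lemma adj_linsub_subproof (S : linsub (bop F E)) :
  submod_closed (mem [set x : bop E F | linsub_set S (adjoint x)]).
Proof.
have [S0 SD] := linsub_closed S; split.
  by rewrite !inE in S0 *; rewrite /= adjoint0.
by move=> a x y; have := SD a^* (adjoint x) (adjoint y); rewrite !inE /= adjoint_linear_comb.
Qed.

Definition adj_linsub (S : linsub (bop F E)) : linsub (bop E F) :=
  LinSub (adj_linsub_subproof S).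

Lemma adj_linsub_closed (S : linsub (bop F E)) :
  closed (linsub_set S) -> closed (linsub_set (adj_linsub S)).
Proof.
move=> Scl x /closure_distP h; apply: Scl; apply/closure_distP => e e0.
have [y Sy xy] := h e e0; exists (adjoint y) => //.
by rewrite -adjointB -rnormE norm_adjoint rnormE.
Qed.

End adjoint_closed_span.

(** The adjoint is isometric and conjugate-linear, so the elements with adjoint in the closed span
    form a closed subspace containing [A]. *)
Lemma closed_span_adjoint (R : realType) (E : hilbertType R) (A : set (bop E E)) :
  (forall x, A x -> A (adjoint x)) ->
  forall x, linsub_set (closed_span A) x -> linsub_set (closed_span A) (adjoint x).
Proof.
move=> Aadj x Ax.
have Acl : closed (linsub_set (closed_span A)) by exact: closed_closure.
apply: (closed_span_sub (adj_linsub_closed Acl) _ Ax) => y /Aadj Ay.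
by apply: subset_closure => S [_ AS]; apply: AS.
Qed.

Section tro_preadjoint.
Context (R : realType) (K H : hilbertType R) (V : tro K H).
Context (P : completeNormedModType R[i]) (phi : isometric_iso V (dual P)).

Let val (x : V) : bop K H := linsub_val x.

Lemma tro_lmul_linear (c : tro_left V) : linear (tro_lmul c).
Proof. by move=> a x y; apply: val_inj; exact: bop_comp_linr. Qed.
Lemma tro_lmul_bounded (c : tro_left V) (x : V) : `|tro_lmul c x| <= `|c| * `|x|.
Proof. exact: bop_comp_norm. Qed.
Definition tro_lmul_bop c : bop V V := mk_bop (tro_lmul_linear c) (tro_lmul_bounded c).

Lemma tro_rmul_linear (d : tro_right V) : linear (fun x : V => tro_rmul x d).
Proof. by move=> a x y; apply: val_inj; exact: bop_comp_linl. Qed.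
Lemma tro_rmul_bounded (d : tro_right V) (x : V) : `|tro_rmul x d| <= `|d| * `|x|.
Proof. by rewrite mulrC; exact: bop_comp_norm. Qed.
Definition tro_rmul_bop d : bop V V := mk_bop (tro_rmul_linear d) (tro_rmul_bounded d).

Lemma tro_left_adjoint (c : tro_left V) : linsub_set (tro_left V) (adjoint (linsub_val c)).
Proof.
apply: (@closed_span_adjoint _ _ _ _ _ (linsubP c)) => _ [x _ [y _ <-]].
by exists y => //; exists x => //; rewrite adjoint_comp adjointK.
Qed.

Lemma tro_right_adjoint (d : tro_right V) : linsub_set (tro_right V) (adjoint (linsub_val d)).
Proof.
apply: (@closed_span_adjoint _ _ _ _ _ (linsubP d)) => _ [x _ [y _ <-]].
by exists y => //; exists x => //; rewrite adjoint_comp adjointK.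
Qed.

Lemma lmul_preadjoint (c : tro_left V) p :
  range (predual_emb phi) (predual_emb phi p \oB tro_lmul_bop c).
Proof.
pose c' : tro_left V := mk_linsub _ (@tro_left_adjoint c).
have q_le (c0 : tro_left V) i x : left_forms V i (tro_lmul_bop c0 x) (tro_lmul_bop c0 x) <=
    rnorm (linsub_val c0) ^+ 2 * left_forms V i x x.
  rewrite /= /left_form !Re_inner_self -exprMn ler_pXn2r ?nnegrE ?mulr_ge0 ?rnorm_ge0//.
  exact: (rnorm_bop (linsub_val c0) (val x (sval i))).
have cc' : rnorm (linsub_val c') = rnorm (linsub_val c) by rewrite norm_adjoint.
apply: (@adjointable_preadjoint _ _ _ _ (left_forms V) (tro_lmul_bop c) (tro_lmul_bop c')
  (rnorm (linsub_val c) ^+ 2)).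
- exact: sqr_ge0.
- by move=> i x y; rewrite /= /left_form /= adjointP.
- exact: q_le.
- by move=> i x; rewrite -cc'; exact: q_le.
Qed.

Lemma rmul_preadjoint (d : tro_right V) p :
  range (predual_emb phi) (predual_emb phi p \oB tro_rmul_bop d).
Proof.
pose d' : tro_right V := mk_linsub _ (@tro_right_adjoint d).
have q_le (d0 : tro_right V) i x : right_forms V i (tro_rmul_bop d0 x) (tro_rmul_bop d0 x) <=
    rnorm (linsub_val d0) ^+ 2 * right_forms V i x x.
  rewrite /= /right_form !Re_inner_self -exprMn ler_pXn2r ?nnegrE ?mulr_ge0 ?rnorm_ge0//.
  rewrite /= adjoint_comp -(norm_adjoint (linsub_val d0)).
  exact: (rnorm_bop (adjoint (linsub_val d0)) (adjoint (val x) (sval i))).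
have dd' : rnorm (linsub_val d') = rnorm (linsub_val d) by rewrite norm_adjoint.
apply: (@adjointable_preadjoint _ _ _ _ (right_forms V) (tro_rmul_bop d) (tro_rmul_bop d')
  (rnorm (linsub_val d) ^+ 2)).
- exact: sqr_ge0.
- move=> i x y; rewrite /= /right_form /= !adjoint_comp adjointK /=.
  by rewrite -[X in inner X _]/(adjoint (linsub_val d) (adjoint (val x) (sval i))) Re_innerC -adjointP Re_innerC.
- exact: q_le.
- by move=> i x; rewrite -dd'; exact: q_le.
Qed.

Lemma predual_subbimodule : is_subbimodule (range (predual_emb phi)).
Proof.
split; first exact: range_predual_submod.
- by move=> d _ [p _ <-]; have [q _ qE] := rmul_preadjoint d p; exists q => //; rewrite qE; exact: bop_ext.
- by move=> _ c [p _ <-]; have [q _ qE] := lmul_preadjoint c p; exists q => //; rewrite qE; exact: bop_ext.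
Qed.

End tro_preadjoint.

(** * Completeness *)

Section completeness.
Context (K : numFieldType) (E : normedModType K).

Lemma linsub_cauchy_cvg (S : linsub E) : closed (linsub_set S) ->
  (forall G : set_system E, ProperFilter G -> cauchy G -> cvg G) ->
  forall F : set_system (linsub_type S), ProperFilter F -> cauchy F -> cvg F.
Proof.
move=> Scl Ecpl F FF /cauchyP Fc.
have cv : cvg ((@linsub_val K E S) @ F).
  apply: Ecpl; apply: cauchy_exP => e /Fc[x Fx]; exists (linsub_val x).
  by move: Fx; rewrite -!ball_normE.
have /cvg_ex[l lP] := cv.
have Sl : linsub_set S l.
  apply: Scl; apply/closure_distP => e e0.
  have /cvgrPdist_lt/(_ e e0)/filter_ex[x xl] := lP.
  by exists (linsub_val x) => //; exact: linsubP.
apply/cvg_ex; exists (mk_linsub S Sl : linsub_type S).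
by apply/cvgrPdist_lt => e e0; have /cvgrPdist_lt/(_ e e0) := lP.
Qed.

End completeness.

(** The closedness proof indexes the type so that completeness can be a structure on it, as required
    of a predual. *)
Definition closed_linsub (K : numFieldType) (E : completeNormedModType K) (S : linsub E)
  (Scl : closed (linsub_set S)) : Type := linsub_type S.

Section closed_linsub.
Context (K : numFieldType) (E : completeNormedModType K) (S : linsub E).
Context (Scl : closed (linsub_set S)).

HB.instance Definition _ := NormedModule.copy (closed_linsub Scl) (linsub_type S).

Lemma closed_linsub_cauchy_cvg (F : set_system (closed_linsub Scl)) :
  ProperFilter F -> cauchy F -> cvg F.
Proof. by apply: linsub_cauchy_cvg => // G; exact: cauchy_cvg. Qed.

HB.instance Definition _ := Uniform_isComplete.Build (closed_linsub Scl) closed_linsub_cauchy_cvg.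

End closed_linsub.

Section bop_complete.
Context (R : realType) (E : normedModType R[i]) (F : completeNormedModType R[i]).

Lemma bop_cauchy_cvg (G : set_system (bop E F)) : ProperFilter G -> cauchy G -> cvg G.
Proof.
move=> GG /cauchyP Gc.
have cv x : cvg ((fun f : bop E F => f x) @ G).
  apply: cauchy_cvg; apply: cauchy_exP => e e0.
  have x0 : 0 < `|x| + 1 by rewrite ltr_wpDl.
  have [f Gf] := Gc _ (divr_gt0 e0 x0); exists (f x).
  suff : G ((fun g : bop E F => g x) @^-1` ball (f x) e) by [].
  apply: filterS Gf => g fg; have h : `|f - g| < e / (`|x| + 1).
    by move: fg; rewrite -ball_normE.
  rewrite ltr_pdivlMr// in h; rewrite -ball_normE /=; rewrite -[f x - g x]/((f - g) x).
  apply: le_lt_trans (bop_ub _ _) _; apply: le_lt_trans h.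
  by rewrite ler_wpM2l// lerDl.
pose l x := lim ((fun f : bop E F => f x) @ G).
have lP x : (fun f : bop E F => f x) @ G --> l x by exact: cv.
have l_linear : linear l.
  move=> a x y; have h : (fun f : bop E F => f (a *: x + y)) @ G --> a *: l x + l y.
    rewrite (_ : (fun f : bop E F => _) = (fun f : bop E F => a *: f x + f y)).
      by apply: cvgD => //; apply: cvgZr => //.
    by apply/funext => f; rewrite linearP.
  exact: cvg_lim h.
(* Uniform in [x]: the intermediate [g] depends on [x], but its distance to [f] is below [e] in any
   case. *)
have near_l (e : R[i]) (f : bop E F) : 0 < e -> G (ball f e) ->
    forall x, `|l x - f x| <= (e + e) * `|x|.
  move=> e0 Gf x; have [->|x0] := eqVneq x 0.
    have l0 : l 0 = 0 by have := l_linear (-1) 0 0; rewrite scaler0 addr0 scaleN1r addNr.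
    by rewrite l0 linear0 subr0 !normr0 mulr0.
  have ex0 : 0 < e * `|x| by rewrite mulr_gt0// normr_gt0.
  have /cvgrPdist_lt/(_ _ ex0) h := lP x.
  have /filter_ex[g [/= lg fg]] : G ([set g : bop E F | `|l x - g x| < e * `|x|] `&` ball f e).
    exact: filterI h Gf.
  have -> : l x - f x = (l x - g x) + (g x - f x) by rewrite addrA subrK.
  apply: le_trans (ler_normD _ _) _; rewrite mulrDl lerD//; first exact: ltW.
  rewrite -[g x - f x]/((g - f) x); apply: le_trans (bop_ub _ _) _.
  by rewrite ler_wpM2r// ltW// distrC; move: fg; rewrite -ball_normE.
have [f0 Gf0] := Gc 1 ltr01.
have l_bounded x : `|l x| <= (1 + 1 + `|f0|) * `|x|.
  rewrite -[l x](subrK (f0 x)); apply: le_trans (ler_normD _ _) _.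
  by rewrite mulrDl lerD// ?bop_ub//; exact: near_l.
apply/cvg_ex; exists (mk_bop l_linear l_bounded); apply/cvgrPdist_le => e e0.
have e3 : 0 < e / 3 by rewrite divr_gt0.
have [f Gf] := Gc _ e3; have lf := near_l _ _ e3 Gf; apply: filterS Gf => g fg.
rewrite -[_ - g](_ : (mk_bop l_linear l_bounded - f) + (f - g) = _); last by rewrite addrA subrK.
apply: le_trans (ler_normD _ _) _.
have -> : e = (e / 3 + e / 3) + e / 3 by field.
rewrite lerD//.
  by apply: bop_le => [|x]; [rewrite addr_ge0// ltW|exact: lf].
by apply: ltW; move: fg; rewrite -ball_normE.
Qed.

End bop_complete.

(** * Weak*-closed fixed spaces *)

Section weak_star.
Context (R : realType) (V : normedModType R[i]) (P : completeNormedModType R[i]).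
Context (phi : isometric_iso V (dual P)).

Lemma weak_star_pairing_continuous p :
  continuous ((fun x => phi x p) : weak_star phi -> R[i]^o).
Proof.
have -> : ((fun x => phi x p) : weak_star phi -> R[i]^o) =
    (fun f : {ptws P -> R[i]^o} => f p) \o
    ((fun x : V => (fun q => phi x q) : {ptws P -> R[i]^o}) : weak_star phi -> {ptws P -> R[i]^o}) by [].
move=> x; apply: continuous_comp; first exact: initial_continuous.
exact: (@proj_continuous P (fun=> R[i]^o) p).
Qed.

(** With [a] pre-adjoint to [A], the fixed points are the common zeros of the weak*-continuous
    pairings with [a p - p]. *)
Lemma weak_star_closed_fix (A : bop V V) :
  (forall p, range (predual_emb phi) (predual_emb phi p \oB A)) ->
  @closed (weak_star phi) [set x | A x = x].
Proof.
move=> hA.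
have /choice[a aP] : forall p, exists q, forall x, phi x q = phi (A x) p.
  move=> p; have [q _ qE] := hA p; exists q => x.
  exact: (congr1 (fun f : dual V => f x) qE).
rewrite [X in closed X](_ : _ = \bigcap_(p in setT)
    ((fun x => phi x (a p - p)) : weak_star phi -> R[i]^o) @^-1` [set 0]).
  apply: closed_bigI => p _; apply: preimage_closed.
    by move=> x _; exact: weak_star_pairing_continuous.
  exact/accessible_closed_set1/hausdorff_accessible/norm_hausdorff.
rewrite eqEsubset; split=> x /= h.
  by move=> p _ /=; rewrite linearB /= aP h subrr.
apply: (iso_inj (phi := phi)); apply: bop_ext => p.
by have := h p I; rewrite /= linearB /= aP => /eqP; rewrite subr_eq0 => /eqP.
Qed.

Context (A : bop V V) (S : linsub V).
Hypotheses (A_norm : forall x, rnorm (A x) <= rnorm x) (AA : forall x, A (A x) = A x).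
Hypothesis A_range : forall x, linsub_set S x <-> A x = x.
Hypothesis A_pre : forall p, range (predual_emb phi) (predual_emb phi p \oB A).

Let fix_linsub_subproof : submod_closed (mem [set p : P | forall x, phi x p = phi (A x) p]).
Proof.
split; first by rewrite inE => x /=; rewrite !linear0.
move=> c p q; rewrite !inE => /= hp hq x.
by rewrite !linearP /= hp hq.
Qed.

Let Q : linsub P := LinSub fix_linsub_subproof.

Let Q_closed : closed (linsub_set Q).
Proof.
move=> p /closure_distP hp x /=; apply/eqP; rewrite -subr_eq0; apply/eqP/(@rnorm0_eq0 _ R[i]^o).
apply: (le_of_small_slope (C := rnorm (x - A x))) => e e0 _; rewrite add0r.
have [|q Qq pq] := hp e%:C; first by rewrite ltcR.
have -> : phi x p - phi (A x) p = phi (x - A x) (p - q).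
  rewrite [phi (x - _)]linearB -[RHS]/(phi x (p - q) - phi (A x) (p - q)) !linearB /=.
  by rewrite [phi x q]Qq; ring.
apply: le_trans (rnorm_pairing _ _ _) _; rewrite ler_wpM2l ?rnorm_ge0//.
by apply: ltW; rewrite -ltcR rnormE.
Qed.

Let pre_exists p : exists q, forall x, phi x q = phi (A x) p.
Proof.
have [q _ qE] := A_pre p; exists q => x.
exact: (congr1 (fun f : dual V => f x) qE).
Qed.

(** The pre-adjoint of [A], a contractive projection of [P] onto [Q]. *)
Let B p : P := sval (cid (pre_exists p)).
Let BE p x : phi x (B p) = phi (A x) p.
Proof. by rewrite /B; case: cid. Qed.

Let BQ p : linsub_set Q (B p).
Proof. by move=> x; rewrite !BE AA. Qed.

Let B_id p : linsub_set Q p -> B p = p.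
Proof. by move=> Qp; apply: (predual_emb_inj (phi := phi)) => x; rewrite BE. Qed.

Let B_norm p : rnorm (B p) <= rnorm p.
Proof.
rewrite -(rnorm_predual_emb phi); apply: rnorm_bop_le => [|x x1]; first exact: rnorm_ge0.
rewrite /= BE; apply: le_trans (rnorm_pairing _ _ _) _.
by rewrite ler_piMl ?rnorm_ge0//; apply: le_trans (A_norm x) x1.
Qed.

Let B_linear c p q : B (c *: p + q) = c *: B p + B q.
Proof.
by apply: (predual_emb_inj (phi := phi)) => x; rewrite BE !linearP /= !BE.
Qed.

Let Qc : completeNormedModType R[i] := closed_linsub Q_closed.

Let restr_linear (x : S) : linear (fun p : Qc => phi (linsub_val x) (linsub_val p) : R[i]^o).
Proof. by move=> c p q; rewrite -linearP. Qed.

Let restr_bounded (x : S) (p : Qc) :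
  `|phi (linsub_val x) (linsub_val p)| <= `|x| * `|p|.
Proof. by rewrite -!rnormE -rmorphM lecR; exact: rnorm_pairing. Qed.

Let restr (x : S) : dual Qc := mk_bop (restr_linear x) (restr_bounded x).

Let restr_is_linear : linear restr.
Proof.
by move=> c x y; apply: bop_ext => p; rewrite /= -[LHS]/(phi (c *: linsub_val x + linsub_val y) _) linearP.
Qed.

HB.instance Definition _ := GRing.isLinear.Build R[i] S (dual Qc) *:%R restr restr_is_linear.

Let BQc p : Qc := mk_linsub Q (BQ p).

Let restr_norm x : `|restr x| = `|x|.
Proof.
rewrite -!rnormE; congr _%:C; apply/eqP; rewrite eq_le; apply/andP; split.
  by rewrite rnorm_lec; apply: bop_le => [|p]; rewrite ?rnormE//; exact: restr_bounded.
rewrite -[rnorm x]/(rnorm (linsub_val x)) -(rnorm_iso phi).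
apply: rnorm_bop_le => [|p p1]; first exact: rnorm_ge0.
(* On [S], pairing with [p] equals pairing with the no longer vector [B p], so restriction to [Q]
   loses no norm. *)
have <- : restr x (BQc p) = phi (linsub_val x) p.
  by rewrite /= BE (A_range _).1//; exact: linsubP.
apply: le_trans (rnorm_bop _ _) _; rewrite ler_piMr ?rnorm_ge0//.
exact: le_trans (B_norm p) p1.
Qed.

Let restr_surj g : exists x, restr x = g.
Proof.
have l : linear (fun p => g (BQc p)).
  by move=> c p q; rewrite -linearP; congr (g _); apply: val_inj; exact: B_linear.
have bd p : `|g (BQc p)| <= `|g| * `|p|.
  apply: le_trans (bop_ub _ _) _; rewrite ler_wpM2l//.
  by rewrite -[`|BQc p|]/`|B p| -rnorm_le.
(* [g] composed with [B] is a functional on [P], hence some [phi x]; then [A x] lies in [S] and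
   restricts to [g]. *)
have [x xE] := iso_surj phi (mk_bop l bd).
have Sx : linsub_set S (A x) by apply/A_range.
exists (mk_linsub S Sx); apply: bop_ext => p.
have Qp : linsub_set Q (linsub_val p) := linsubP p.
rewrite /= -Qp xE /=; congr (g _); apply: val_inj; exact: B_id.
Qed.

(* The predual is the fixed space of the pre-adjoint of A. *)
Lemma fixed_space_predual :
  exists P' : completeNormedModType R[i], inhabited (isometric_iso S (dual P')).
Proof.
exists Qc; split; exact: (@IsometricIso R S (dual Qc) restr restr_norm restr_surj).
Qed.

End weak_star.

(** * The corner of a partial isometry *)

Section partial_isometry.
Context (R : realType) (K H : hilbertType R) (r : bop K H).
Hypothesis rP : partial_isometry r.

(** The range of [adjoint r] is orthogonal to the kernel of [r]. *)
Lemma partial_isometry_adjoint v : rnorm (r (adjoint r v)) = rnorm (adjoint r v).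
Proof.
rewrite /rnorm rP// => w rw0.
by rewrite innerC -adjointP rw0 inner0l conjC0.
Qed.

Lemma partial_isometry_norm_le1 : rnorm r <= 1.
Proof.
rewrite -norm_adjoint; apply: rnorm_bop_le => // v v1; apply: le_trans v1.
have := rnorm_ge0 (adjoint r v); rewrite le_eqVlt => /predU1P[<-|x0]; first exact: rnorm_ge0.
rewrite -(ler_pM2r x0) -expr2 -Re_inner_self -adjointP mulrC -partial_isometry_adjoint.
apply: le_trans (Re_le_rnorm _) _.
by have := Cauchy_Schwarz (r (adjoint r v)) v; rewrite -!rnormE -rmorphM lecR.
Qed.

(** For [w = r r^* v], expand the squared norm of [r^* v - r^* w]: the cross term is [|r^* v|^2] and
    [|r^* w| <= |r^* v|], so it is at most 0. *)
Lemma partial_isometry_adjoint_id : adjoint r \oB r \oB adjoint r = adjoint r.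
Proof.
apply: bop_ext => v; apply/eqP; rewrite eq_sym -subr_eq0; apply/eqP/rnorm0_eq0.
rewrite -(@ler_pXn2r _ 2) ?nnegrE ?rnorm_ge0// expr0n /=.
set w := r (adjoint r v).
have ww : rnorm (adjoint r w) <= rnorm (adjoint r v).
  rewrite -[X in _ <= X]partial_isometry_adjoint -/w; apply: le_trans (rnorm_bop _ _) _.
  by rewrite norm_adjoint ler_piMl ?rnorm_ge0// partial_isometry_norm_le1.
have vw : complex.Re (inner (adjoint r v) (adjoint r w)) = rnorm (adjoint r v) ^+ 2.
  by rewrite -adjointP Re_inner_self partial_isometry_adjoint.
rewrite -Re_inner_self !(innerBl, innerBr) !raddfB /= [complex.Re (inner (adjoint r w) (adjoint r v))]Re_innerC vw.
have : rnorm (adjoint r w) ^+ 2 <= rnorm (adjoint r v) ^+ 2.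
  by rewrite ler_pXn2r ?nnegrE ?rnorm_ge0.
rewrite !Re_inner_self; lra.
Qed.

Lemma partial_isometry_id : r \oB adjoint r \oB r = r.
Proof.
have := congr1 (@adjoint _ _ _) partial_isometry_adjoint_id.
by rewrite !adjoint_comp !adjointK bop_compA.
Qed.

End partial_isometry.

(** * The corner as a W*-algebra *)

Section corner_theory.
Context (R : realType) (K H : hilbertType R) (V : tro K H) (r : V).
Let r0 : bop K H := linsub_val r.
Hypothesis rP : partial_isometry r0.

Let rr_left : linsub_set (tro_left V) (r0 \oB adjoint r0).
Proof. by apply: subset_closure => S [_ AS]; apply: AS; exists r => //; exists r. Qed.

Let rr_right : linsub_set (tro_right V) (adjoint r0 \oB r0).
Proof. by apply: subset_closure => S [_ AS]; apply: AS; exists r => //; exists r. Qed.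

(** [L] and [M] are commuting contractive idempotents whose common fixed space is the corner; as
    actions of C and D they have pre-adjoints. *)
Let L : bop V V := tro_lmul_bop (mk_linsub (tro_left V) rr_left).
Let M : bop V V := tro_rmul_bop (mk_linsub (tro_right V) rr_right).

Let cornerP x : corner_set r x <-> L x = x /\ M x = x.
Proof.
split=> [[h1 h2]|[h1 h2]]; split.
- exact: val_inj.
- by apply: val_inj; rewrite /= -[RHS]h2 /= bop_compA.
- exact: (congr1 val h1).
- by have := congr1 val h2; rewrite /= bop_compA.
Qed.

Let rr_norm : rnorm (r0 \oB adjoint r0) <= 1 /\ rnorm (adjoint r0 \oB r0) <= 1.
Proof.
have r1 := partial_isometry_norm_le1 rP; have r0' := rnorm_ge0 r0.
have h E F G (f : bop F G) (g : bop E F) : rnorm f <= 1 -> rnorm g <= 1 -> rnorm (f \oB g) <= 1.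
  by move=> f1 g1; apply: le_trans (rnorm_comp _ _) _; rewrite mulr_ile1// rnorm_ge0.
have r1a : rnorm (adjoint r0) <= 1 by rewrite norm_adjoint.
by split; exact: h.
Qed.

Let L_norm x : rnorm (L x) <= rnorm x.
Proof.
rewrite rnorm_lec rnormE; apply: le_trans (tro_lmul_bounded _ _) _.
by rewrite -[leRHS]mul1r ler_wpM2r// -rnormE lecR; exact: rr_norm.1.
Qed.

Let M_norm x : rnorm (M x) <= rnorm x.
Proof.
rewrite rnorm_lec rnormE; apply: le_trans (tro_rmul_bounded _ _) _.
by rewrite -[leRHS]mul1r ler_wpM2r// -rnormE lecR; exact: rr_norm.2.
Qed.

Let LL x : L (L x) = L x.
Proof.
apply: val_inj; rewrite /= -/r0 bop_compA; congr (_ \oB _).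
by rewrite bop_compA (partial_isometry_id rP).
Qed.

Let MM x : M (M x) = M x.
Proof.
apply: val_inj; rewrite /= -/r0 -bop_compA; congr (_ \oB _).
by rewrite bop_compA (partial_isometry_adjoint_id rP).
Qed.

Let LM x : L (M x) = M (L x).
Proof. by apply: val_inj; rewrite /= bop_compA. Qed.

Lemma corner_cauchy_cvg (F : set_system (corner r)) : ProperFilter F -> cauchy F -> cvg F.
Proof.
apply: linsub_cauchy_cvg => [x /closure_distP hx|G].
  have fixP (A : bop V V) : (forall y, rnorm (A y) <= rnorm y) ->
      (forall y, corner_set r y -> A y = y) -> A x = x.
    move=> A1 Ay; apply/eqP; rewrite -subr_eq0; apply/eqP/rnorm0_eq0.
    apply: (le_of_small_slope (C := 2)) => e e0 _; rewrite add0r.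
    have [|y Sy xy] := hx e%:C; first by rewrite ltcR.
    have {}xy : rnorm (x - y) <= e by apply: ltW; rewrite -ltcR rnormE.
    have -> : A x - x = A (x - y) - (x - y) by rewrite linearB /= (Ay y Sy) opprB addrA subrK.
    apply: le_trans (rnormD _ _) _; rewrite rnormN; have := A1 (x - y); lra.
  by apply/cornerP; split; apply: fixP => // y /cornerP[].
by apply: linsub_cauchy_cvg => [|G']; [exact: tro_closed|exact: bop_cauchy_cvg].
Qed.

Let val (x : corner r) : bop K H := linsub_val (linsub_val x).

Let val_ext x y : val x = val y -> x = y.
Proof. by move=> xy; do 2 apply: val_inj. Qed.

Let valr x : r0 \oB adjoint r0 \oB val x = val x.
Proof. by have [] := linsubP x. Qed.

Let valrr x : adjoint r0 \oB r0 \oB adjoint (val x) = adjoint (val x).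
Proof.
have [_ h] := linsubP x.
by have := congr1 (@adjoint _ _ _) h; rewrite !adjoint_comp adjointK bop_compA.
Qed.

Let val_linear a x y : val (a *: x + y) = a *: val x + val y.
Proof. by []. Qed.

Let val_mul x y : val (corner_mul x y) = val x \oB adjoint r0 \oB val y.
Proof. by []. Qed.

Let val_add x y : val (x + y) = val x + val y.
Proof. by []. Qed.

Let val_scale a x : val (a *: x) = a *: val x.
Proof. by []. Qed.

Let val_star x : val (corner_star x) = r0 \oB adjoint (val x) \oB r0.
Proof. by []. Qed.

Lemma corner_cstar : is_cstar_algebra (@corner_mul R K H V r) (@corner_star R K H V r).
Proof.
have r1 := partial_isometry_norm_le1 rP.
split.
- by move=> x y z; apply: val_ext; rewrite /val /= !bop_compA.
- move=> y a x z; apply: val_ext.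
  by rewrite val_linear !val_mul val_linear !bop_comp_linl.
- move=> x a y z; apply: val_ext.
  by rewrite val_linear !val_mul val_linear bop_comp_linr.
- move=> x; apply: val_ext; rewrite !val_star !adjoint_comp adjointK !bop_compA valr.
  by have [_] := linsubP x.
- move=> x y; apply: val_ext; rewrite val_add !val_star val_add adjointD.
  by rewrite -[adjoint (val x)]scale1r bop_comp_linr bop_comp_linl !scale1r.
- move=> a x; apply: val_ext; rewrite val_scale !val_star val_scale adjointZ.
  apply: bop_ext => u.
  by rewrite -[LHS]/(r0 (a^* *: adjoint (val x) (r0 u))) linearZ.
- move=> x y; apply: val_ext; rewrite val_mul !val_star val_mul !adjoint_comp adjointK.
  have rrr (f : bop H H) : f \oB r0 \oB adjoint r0 \oB r0 = f \oB r0.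
    by rewrite -!bop_compA [r0 \oB (adjoint r0 \oB r0)]bop_compA (partial_isometry_id rP).
  by rewrite !bop_compA rrr.
- move=> x y; rewrite -!rnormE -rmorphM lecR.
  have -> : rnorm (corner_mul x y) = rnorm (val (corner_mul x y)) by [].
  rewrite val_mul -[rnorm x]/(rnorm (val x)) -[rnorm y]/(rnorm (val y)).
  apply: (le_trans (rnorm_comp _ _)); rewrite ler_wpM2r ?rnorm_ge0//.
  apply: (le_trans (rnorm_comp _ _)).
  by rewrite norm_adjoint ler_piMr ?rnorm_ge0.
(* The product is [r x^* x], because [r r^* x = x]. Its norm is at least that of [x^* x], because
   [r^* r x^* = x^*] recovers [x^* x] from it by a contraction; and [|x u|^2 = <x^* x u, u>]. *)
- move=> x; rewrite -!rnormE -rmorphXn; congr _%:C.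
  have -> : rnorm (corner_mul (corner_star x) x) = rnorm (r0 \oB adjoint (val x) \oB val x).
    have -> : rnorm (corner_mul (corner_star x) x) = rnorm (val (corner_mul (corner_star x) x)) by [].
    by rewrite val_mul val_star -!bop_compA [r0 \oB (_ \oB val x)]bop_compA valr.
  rewrite -[rnorm x]/(rnorm (val x)); set N := rnorm (_ \oB _ \oB _).
  apply/eqP; rewrite eq_le; apply/andP; split.
    apply: (le_trans (rnorm_comp _ _)); rewrite expr2 ler_wpM2r ?rnorm_ge0//.
    by apply: (le_trans (rnorm_comp _ _)); rewrite norm_adjoint ler_piMl ?rnorm_ge0.
  apply: (le_of_small_slope (C := 1)) => e e0 _; rewrite mul1r -lerBlDr.
  have [u u1 xu] := bop_norm_approx (val x) e0; apply: le_trans xu _.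
  rewrite -Re_inner_self adjointP Re_innerC; apply: le_trans (Re_le_rnorm _) _.
  have := Cauchy_Schwarz (adjoint (val x) (val x u)) u.
  rewrite -!rnormE -rmorphM lecR => /le_trans; apply.
  apply: le_trans (_ : rnorm (adjoint (val x) (val x u)) <= _).
    by rewrite ler_piMr ?rnorm_ge0.
  have -> : adjoint (val x) (val x u) = adjoint r0 ((r0 \oB adjoint (val x) \oB val x) u).
    exact: (congr1 (fun f : bop H K => f (val x u)) (esym (valrr x))).
  apply: le_trans (rnorm_bop _ _) _; rewrite norm_adjoint.
  apply: le_trans (_ : rnorm ((r0 \oB adjoint (val x) \oB val x) u) <= _).
    by rewrite ler_piMl ?rnorm_ge0.
  by apply: le_trans (rnorm_bop _ _) _; rewrite ler_piMr ?rnorm_ge0.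
- exact: corner_cauchy_cvg.
Qed.

Context (P : completeNormedModType R[i]) (phi : isometric_iso V (dual P)).

Lemma corner_weak_star_closed : @closed (weak_star phi) (linsub_set (corner r)).
Proof.
rewrite [X in closed X](_ : _ = [set x | L x = x] `&` [set x | M x = x]).
  by apply: closedI; apply: weak_star_closed_fix => p; [exact: lmul_preadjoint|exact: rmul_preadjoint].
by rewrite eqEsubset; split=> x /cornerP.
Qed.

Lemma corner_predual :
  exists P' : completeNormedModType R[i], inhabited (isometric_iso (corner r) (dual P')).
Proof.
have E x : (M \oB L) x = M (L x) by [].
apply: (@fixed_space_predual _ _ _ phi (M \oB L)).
- by move=> x; rewrite E; apply: le_trans (M_norm _) (L_norm _).
- by move=> x; rewrite !E LM LL MM.
- move=> x; rewrite E; split=> [/cornerP[h1 h2]|h]; first by rewrite h1 h2.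
  apply/cornerP; rewrite -h; split; last by rewrite MM.
  by rewrite LM LL.
(* Pre-adjoints compose in the reverse order: first that of [M], then that of [L]. *)
- move=> p; have [q _ qE] := rmul_preadjoint phi (mk_linsub (tro_right V) rr_right) p.
  rewrite bop_compA -qE; exact: lmul_preadjoint.
Qed.

End corner_theory.

Theorem proposition3p2 (R : realType) (H K : hilbertType R) (V : tro K H)
    (Vpred : completeNormedModType R[i])
    (phi : isometric_iso V (dual Vpred)) :
  is_subbimodule (range (predual_emb phi)) /\
  forall r : V, partial_isometry (linsub_val r) ->
    @closed (weak_star phi) (linsub_set (corner r)) /\
    is_wstar_algebra (@corner_mul R K H V r) (@corner_star R K H V r).
Proof.
split; first exact: predual_subbimodule.
move=> r rP; split; first exact: corner_weak_star_closed.
by split; [exact: corner_cstar|exact: corner_predual phi].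
Qed.
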